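(* Let $H$ be a finite group acting on a finite-dimensional $k$-vector space $V$ and let $C$ be the coinvariant algebra of this action. A given $\mathcal F\in\operatorname{QCoh}(\operatorname{Spec}(C))^H$ descends to the coarse quotient $\operatorname{Spec}(C)/\!/H=\operatorname{Spec}(k)$ if and only if the canonical $H$-representation on $i^*(\mathcal F)$ is trivial, where $i:\operatorname{Spec}(k)\hookrightarrow\operatorname{Spec}(C)$ is the inclusion of the unique closed point.
   Context: $k$ is a field of characteristic zero. The coinvariant algebra is $C=\operatorname{Sym}(V^\vee)/(\operatorname{Sym}(V^\vee)^H_+)$, the quotient by the ideal generated by homogeneous $H$-invariant polynomials of positive degree; $H$ acts on $C$ and $C^H=k$. $\operatorname{QCoh}$ denotes the unbounded derived category (as a DG category), and all functors, in particular $i^*$, are derived. $\operatorname{QCoh}(\operatorname{Spec}(C))^H\simeq\operatorname{QCoh}(\operatorname{Spec}(C)/H)$ is the derived category of $H$-equivariant sheaves, where $\operatorname{Spec}(C)/H$ is the stack quotient. $\mathcal F$ descends to the coarse quotient $\operatorname{Spec}(C)/\!/H:=\operatorname{Spec}(C^H)=\operatorname{Spec}(k)$ if it lies in the essential image of pullback along $\operatorname{Spec}(C)/H\to\operatorname{Spec}(k)$. An object of the derived category $\operatorname{Rep}(H)$ is called trivial if it lies in the full subcategory generated under colimits by the trivial one-dimensional representation, equivalently $H$ acts trivially on all cohomology groups. *)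

(* Defs.v *)
From HB Require Import structures.
From mathcomp Require Import all_boot all_order all_algebra all_fingroup.
From mathcomp Require Import generic_quotient ring_quotient mxrepresentation.
From mathcomp Require Import finmap boolp.
From mathcomp.multinomials Require Import monalg mpoly.

Set Implicit Arguments.
Unset Strict Implicit.
Unset Printing Implicit Defensive.

Import GRing.Theory.

Local Open Scope ring_scope.
Local Open Scope quotient_scope.

(* monalg and mpoly both declare this notation; mpoly's reading is the one
   used here. *)
Notation "{ 'mpoly' T [ n ] }" := (mpoly.mpoly n T) : type_scope.

Section Span.
Variables (R : comNzRingType) (V : lmodType R) (G : V -> Prop).

Definition in_span (x : V) : Prop :=
  exists s : seq (R * V),
    {in s, forall y, G y.2} /\ x = \sum_(y <- s) y.1 *: y.2.

Definition span_pred : V -> bool := fun x => `[< in_span x >].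

Lemma span_predP x : reflect (in_span x) (x \in span_pred).
Proof. exact: asboolP. Qed.

Lemma span_gen x : G x -> x \in span_pred.
Proof.
move=> Gx; apply/span_predP; exists [:: (1, x)]; rewrite big_seq1 scale1r.
by split=> // y; rewrite inE => /eqP->.
Qed.

Lemma span_submod_closed : submod_closed span_pred.
Proof.
split; first by apply/span_predP; exists [::]; rewrite big_nil.
move=> a u v /span_predP[s [Gs ->]] /span_predP[t [Gt ->]].
apply/span_predP; exists ([seq (a * y.1, y.2) | y <- s] ++ t); split.
  move=> y; rewrite mem_cat => /orP[/mapP[z zs ->]|/Gt//]; exact: Gs zs.
rewrite big_cat big_map scaler_sumr; congr (_ + _).
by apply: eq_bigr => y _; rewrite scalerA.
Qed.

Lemma span_scale a u : u \in span_pred -> a *: u \in span_pred.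
Proof.
have [S0 Slin] := span_submod_closed.
by move=> Su; rewrite -[_ *: _]addr0; apply: Slin.
Qed.

Lemma span_min (D : V -> Prop) :
    D 0 -> (forall a u v, D u -> D v -> D (a *: u + v)) ->
    (forall x, G x -> D x) ->
  forall x, x \in span_pred -> D x.
Proof.
move=> D0 Dlin DG x /span_predP[s [Gs ->]].
elim: s Gs => [|y s IHs] Gs; first by rewrite big_nil.
rewrite big_cons; apply: Dlin; first by apply: DG; apply: Gs; rewrite mem_head.
by apply: IHs => z zs; apply: Gs; rewrite inE zs orbT.
Qed.

HB.instance Definition _ :=
  GRing.isZmodClosed.Build V span_pred (GRing.submod_closedB span_submod_closed).

Definition span : zmodClosed V := GRing.ZmodClosed.clone V span_pred _.

End Span.

(* The extension of scalars B (x)_A M along f : A -> B, presented as the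
   B-module generated by the symbols 1 (x) x for x in M, subject to
   1 (x) (x + y) = 1 (x) x + 1 (x) y and 1 (x) (a x) = f a (1 (x) x). *)
Section Extension.
Variables (A B : comNzRingType) (f : {rmorphism A -> B}) (M : lmodType A).

Local Notation free := {malg B[M]}.

Variant ext_rel : free -> Prop :=
| ExtRelD x y : ext_rel (<< x + y >> - << x >> - << y >>)
| ExtRelZ a x : ext_rel (<< a *: x >> - f a *: << x >>).

Definition ext : Type := {ideal_quot (span ext_rel)}.
HB.instance Definition _ := GRing.Zmodule.on ext.

Definition ext_pi (u : free) : ext := \pi_({ideal_quot (span ext_rel)}) u.

Lemma ext_pi_surj x : exists u, x = ext_pi u.
Proof. by exists (repr x); rewrite /ext_pi reprK. Qed.

Lemma ext_pi_eq u v : (ext_pi u == ext_pi v) = (u - v \in span_pred ext_rel).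
Proof. by rewrite /ext_pi piE. Qed.

Lemma ext_piD u v : ext_pi (u + v) = ext_pi u + ext_pi v.
Proof. exact: raddfD. Qed.

Lemma ext_pi0 : ext_pi 0 = 0.
Proof. exact: raddf0. Qed.

Definition ext_scale (b : B) (x : ext) : ext :=
  ext_pi (b *: repr (x : {ideal_quot (span ext_rel)})).

Lemma ext_scale_pi b u : ext_scale b (ext_pi u) = ext_pi (b *: u).
Proof.
apply/eqP; rewrite ext_pi_eq -scalerBr span_scale // -ext_pi_eq.
by rewrite /ext_pi reprK.
Qed.

Lemma ext_scaleA b c x : ext_scale b (ext_scale c x) = ext_scale (b * c) x.
Proof. by have [u ->] := ext_pi_surj x; rewrite !ext_scale_pi scalerA. Qed.

Lemma ext_scale1 : left_id 1 ext_scale.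
Proof.
by move=> x; have [u ->] := ext_pi_surj x; rewrite ext_scale_pi scale1r.
Qed.

Lemma ext_scaleDr : right_distributive ext_scale +%R.
Proof.
move=> b x y; have [u ->] := ext_pi_surj x; have [v ->] := ext_pi_surj y.
by rewrite -ext_piD !ext_scale_pi -ext_piD scalerDr.
Qed.

Lemma ext_scaleDl x : {morph ext_scale^~ x : b c / b + c}.
Proof.
move=> b c; have [u ->] := ext_pi_surj x.
by rewrite !ext_scale_pi -ext_piD scalerDl.
Qed.

HB.instance Definition _ := GRing.Zmodule_isLmodule.Build B ext
  ext_scaleA ext_scale1 ext_scaleDr ext_scaleDl.

Lemma ext_piZ b u : ext_pi (b *: u) = b *: ext_pi u.
Proof. by rewrite -ext_scale_pi. Qed.

Definition ext_in (x : M) : ext := ext_pi << x >>.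

Lemma ext_inD x y : ext_in (x + y) = ext_in x + ext_in y.
Proof.
apply/eqP; rewrite -ext_piD ext_pi_eq opprD addrA.
exact/span_gen/ExtRelD.
Qed.

Lemma ext_in0 : ext_in 0 = 0.
Proof. by apply: (addIr (ext_in 0)); rewrite -ext_inD !add0r. Qed.

Lemma ext_inZ a x : ext_in (a *: x) = f a *: ext_in x.
Proof.
apply/eqP; rewrite -ext_piZ ext_pi_eq.
exact/span_gen/ExtRelZ.
Qed.

Lemma ext_ind (D : ext -> Prop) :
    D 0 -> (forall x y, D x -> D y -> D (x + y)) ->
    (forall b x, D (b *: ext_in x)) ->
  forall x, D x.
Proof.
move=> D0 DD Dg x; have [u ->] := ext_pi_surj x; rewrite [u]monalgE.
rewrite (big_morph ext_pi ext_piD ext_pi0).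
apply: (big_ind D) => // m _.
suff -> : << monalg.mcoeff m u *g m >> = monalg.mcoeff m u *: (<< m >> : free).
  by rewrite ext_piZ; exact: Dg.
by apply/malgP=> k; rewrite monalg.mcoeffZ !monalg.mcoeffU mulrnAr mulr1.
Qed.

Section Lift.
Variables (s : {rmorphism B -> B}) (N : lmodType B) (phi : M -> N).
Hypothesis phiD : {morph phi : x y / x + y}.
Hypothesis phiZ : forall a x, phi (a *: x) = s (f a) *: phi x.

Definition free_lift (u : free) : N :=
  \sum_(x <- monalg.msupp u) s (monalg.mcoeff x u) *: phi x.

Lemma free_liftE (d : {fset M}) u : (monalg.msupp u `<=` d)%fset ->
  free_lift u = \sum_(x <- d) s (monalg.mcoeff x u) *: phi x.
Proof.
move=> sud; rewrite /free_lift (big_fset_incl _ sud) //= => x _ xu.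
by rewrite monalg.mcoeff_outdom // rmorph0 scale0r.
Qed.

Lemma free_lift_lin b u v : free_lift (b *: u + v) = s b *: free_lift u + free_lift v.
Proof.
pose d := (monalg.msupp u `|` monalg.msupp v `|` monalg.msupp (b *: u + v))%fset.
have du : (monalg.msupp u `<=` d)%fset by rewrite /d -fsetUA fsubsetUl.
have dv : (monalg.msupp v `<=` d)%fset.
  by rewrite /d [(_ `|` monalg.msupp v)%fset]fsetUC -fsetUA fsubsetUl.
have dw : (monalg.msupp (b *: u + v) `<=` d)%fset by rewrite /d fsubsetUr.
rewrite (free_liftE du) (free_liftE dv) (free_liftE dw) scaler_sumr -big_split /=.
apply: eq_bigr => x _.
by rewrite monalg.mcoeffD monalg.mcoeffZ rmorphD rmorphM scalerDl scalerA.
Qed.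

Lemma free_liftU x : free_lift << x >> = phi x.
Proof.
rewrite (free_liftE (d := [fset x]%fset)) ?monalg.msuppU_le //.
by rewrite big_seq_fset1 monalg.mcoeffUU rmorph1 scale1r.
Qed.

Lemma free_lift0 : free_lift 0 = 0.
Proof. by rewrite /free_lift monalg.msupp0 big_seq_fset0. Qed.

Lemma free_liftB u v : free_lift (u - v) = free_lift u - free_lift v.
Proof.
have -> : u - v = -1 *: v + u by rewrite scaleN1r addrC.
by rewrite free_lift_lin rmorphN1 scaleN1r addrC.
Qed.

Lemma free_lift_rel u : u \in span_pred ext_rel -> free_lift u = 0.
Proof.
have liftZ b v : free_lift (b *: v) = s b *: free_lift v.
  by rewrite -[b *: v]addr0 free_lift_lin free_lift0 addr0.
move: u; apply: span_min; first exact: free_lift0.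
  by move=> b u v u0 v0; rewrite free_lift_lin u0 v0 scaler0 addr0.
move=> _ [x y|a x]; rewrite !free_liftB ?liftZ !free_liftU ?phiD ?phiZ ?subrr //.
by rewrite addrAC addrK subrr.
Qed.

(* b (x) x |-> s b *: phi x *)
Definition ext_lift (x : ext) : N :=
  free_lift (repr (x : {ideal_quot (span ext_rel)})).

Lemma ext_lift_pi u : ext_lift (ext_pi u) = free_lift u.
Proof.
have : repr (ext_pi u : {ideal_quot (span ext_rel)}) - u \in span_pred ext_rel.
  by rewrite -ext_pi_eq /ext_pi reprK.
move/free_lift_rel => E; apply/eqP; rewrite -subr_eq0 -E.
by rewrite free_liftB.
Qed.

Lemma ext_liftD : {morph ext_lift : x y / x + y}.
Proof.
move=> x y; have [u ->] := ext_pi_surj x; have [v ->] := ext_pi_surj y.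
rewrite -ext_piD !ext_lift_pi -[u in LHS]scale1r free_lift_lin rmorph1.
by rewrite scale1r.
Qed.

Lemma ext_liftZ b x : ext_lift (b *: x) = s b *: ext_lift x.
Proof.
have [u ->] := ext_pi_surj x.
by rewrite -ext_piZ !ext_lift_pi -[_ *: u]addr0 free_lift_lin free_lift0 addr0.
Qed.

Lemma ext_lift_in x : ext_lift (ext_in x) = phi x.
Proof. by rewrite ext_lift_pi free_liftU. Qed.

End Lift.
End Extension.

Section Equivariant.
Variable H : finGroupType.

(* A commutative ring with an action of H: the affine scheme Spec A with
   H-action. *)
Record gring := MkGRing {
  gring_ring :> comNzRingType;
  gact : H -> {rmorphism gring_ring -> gring_ring};
  gact1 : forall a, gact 1%g a = a;
  gactM : forall g h a, gact (g * h)%g a = gact g (gact h a)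
}.

Record ghom (A B : gring) := GHom {
  ghom_fun :> {rmorphism A -> B};
  ghomJ : forall h a, ghom_fun (gact A h a) = gact B h (ghom_fun a)
}.

(* An H-equivariant quasi-coherent sheaf on Spec A. *)
Record eqmod (A : gring) := EqMod {
  eqmod_mod :> lmodType A;
  eact : H -> eqmod_mod -> eqmod_mod;
  eactD : forall h, {morph eact h : x y / x + y};
  eactZ : forall h a x, eact h (a *: x) = gact A h a *: eact h x;
  eact1 : forall x, eact 1%g x = x;
  eactM : forall g h x, eact (g * h)%g x = eact g (eact h x)
}.

Record ehom (A : gring) (M N : eqmod A) := EHom {
  ehom_fun :> {linear M -> N};
  ehomJ : forall h x, ehom_fun (eact h x) = eact h (ehom_fun x)
}.

(* Unbounded cochain complexes of H-equivariant A-modules.  The differential is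
   indexed by all pairs (i, j) and vanishes unless j = i + 1, which avoids
   casts between the indices (i - 1) + 1 and i. *)
Record cpx (A : gring) := Cpx {
  cpx_obj :> int -> eqmod A;
  cpx_d : forall i j, ehom (cpx_obj i) (cpx_obj j);
  cpx_shape : forall i j x, j != i + 1 -> cpx_d i j x = 0;
  cpx_dd : forall i j l x, cpx_d j l (cpx_d i j x) = 0
}.

Record cmap (A : gring) (X Y : cpx A) := CMap {
  cmap_fun :> forall i, ehom (X i) (Y i);
  cmapD : forall i j x, cmap_fun j (cpx_d X i j x) = cpx_d Y i j (cmap_fun i x)
}.

Section Derived.
Variable A : gring.
Implicit Types X Y Z : cpx A.

Definition cocycle X i (x : X i) : Prop := cpx_d X i (i + 1) x = 0.

Definition coboundary X i (x : X i) : Prop :=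
  exists y : X (i - 1), x = cpx_d X (i - 1) i y.

Definition acyclic X : Prop := forall i (x : X i), cocycle x -> coboundary x.

(* f induces a bijection on every cohomology group. *)
Definition quasi_iso X Y (f : cmap X Y) : Prop := forall i,
  (forall x : X i, cocycle x -> coboundary (f i x) -> coboundary x) /\
  (forall y : Y i, cocycle y ->
     exists x : X i, cocycle x /\ coboundary (y - f i x)).

(* X and Y are isomorphic in the derived category of H-equivariant A-modules. *)
Definition derived_iso X Y : Prop :=
  exists Z (f : cmap Z X) (g : cmap Z Y), quasi_iso f /\ quasi_iso g.

Definition null_homotopic X Y (f : cmap X Y) : Prop :=
  exists s : forall i j, ehom (X i) (Y j), forall i (x : X i),
    f i x = cpx_d Y (i - 1) i (s i (i - 1) x) + s (i + 1) i (cpx_d X i (i + 1) x).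

(* Spaltenstein's K-projectivity, in the category of H-equivariant modules. *)
Definition Kprojective X : Prop :=
  forall Y (f : cmap X Y), acyclic Y -> null_homotopic f.

(* H acts trivially on every cohomology group of X. *)
Definition cohomology_trivial X : Prop :=
  forall i (x : X i) h, cocycle x -> coboundary (eact h x - x).

End Derived.

Section BaseChange.
Variables (A B : gring) (f : ghom A B).

Section Module.
Variable M : eqmod A.

Local Notation extM := (ext f M).

Definition bc_phi h (x : M) : extM := ext_in f (eact h x).

Lemma bc_phiD h : {morph bc_phi h : x y / x + y}.
Proof. by move=> x y; rewrite /bc_phi eactD ext_inD. Qed.

Lemma bc_phiZ h a x : bc_phi h (a *: x) = gact B h (f a) *: bc_phi h x.
Proof. by rewrite /bc_phi eactZ ext_inZ ghomJ. Qed.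

(* h (b (x) x) = h b (x) h x *)
Definition bc_act h : extM -> extM := ext_lift (gact B h) (bc_phi h).

Lemma bc_actD h : {morph bc_act h : x y / x + y}.
Proof. exact: (ext_liftD (@bc_phiD h) (@bc_phiZ h)). Qed.

Lemma bc_actZ h b x : bc_act h (b *: x) = gact B h b *: bc_act h x.
Proof. exact: (ext_liftZ (@bc_phiD h) (@bc_phiZ h)). Qed.

Lemma bc_act_in h x : bc_act h (ext_in f x) = ext_in f (eact h x).
Proof. exact: (ext_lift_in (@bc_phiD h) (@bc_phiZ h)). Qed.

Lemma bc_act0 h : bc_act h 0 = 0.
Proof. by apply: (addIr (bc_act h 0)); rewrite -bc_actD !add0r. Qed.

Lemma bc_act1 x : bc_act 1%g x = x.
Proof.
elim/ext_ind: x => [|x y IHx IHy|b x]; first exact: bc_act0.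
  by rewrite bc_actD IHx IHy.
by rewrite bc_actZ bc_act_in gact1 eact1.
Qed.

Lemma bc_actM g h x : bc_act (g * h)%g x = bc_act g (bc_act h x).
Proof.
elim/ext_ind: x => [|x y IHx IHy|b x]; first by rewrite !bc_act0.
  by rewrite !bc_actD IHx IHy.
by rewrite !(bc_actZ, bc_act_in) gactM eactM.
Qed.

Definition bc_mod : eqmod B := EqMod bc_actD bc_actZ bc_act1 bc_actM.

End Module.

Section Hom.
Variables (M N : eqmod A) (u : ehom M N).

Definition bc_psi (x : M) : ext f N := ext_in f (u x).

Lemma bc_psiD : {morph bc_psi : x y / x + y}.
Proof. by move=> x y; rewrite /bc_psi raddfD ext_inD. Qed.

Lemma bc_psiZ a x : bc_psi (a *: x) = (idfun (f a)) *: bc_psi x.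
Proof. by rewrite /bc_psi linearZ ext_inZ. Qed.

(* b (x) x |-> b (x) u x *)
Definition bc_map : bc_mod M -> bc_mod N := ext_lift idfun bc_psi.

Lemma bc_map_in x : bc_map (ext_in f x) = ext_in f (u x).
Proof. exact: (ext_lift_in bc_psiD bc_psiZ). Qed.

Lemma bc_map_linear : linear bc_map.
Proof.
move=> b x y; rewrite /bc_map (ext_liftD bc_psiD bc_psiZ).
by rewrite (ext_liftZ bc_psiD bc_psiZ).
Qed.

Lemma bc_mapD x y : bc_map (x + y) = bc_map x + bc_map y.
Proof. by rewrite -[x in LHS]scale1r bc_map_linear scale1r. Qed.

Lemma bc_map0 : bc_map 0 = 0.
Proof. by apply: (addIr (bc_map 0)); rewrite -bc_mapD !add0r. Qed.

Lemma bc_mapZ b x : bc_map (b *: x) = b *: bc_map x.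
Proof. by rewrite -[_ *: x]addr0 bc_map_linear bc_map0 addr0. Qed.

HB.instance Definition _ :=
  GRing.isLinear.Build B (bc_mod M) (bc_mod N) _ bc_map bc_map_linear.

Lemma bc_mapJ h x : bc_map (eact h x) = eact h (bc_map x).
Proof.
elim/ext_ind: x => [|x y IHx IHy|b x].
- by rewrite /= bc_act0 bc_map0 bc_act0.
- by move: IHx IHy; rewrite /= !(bc_actD, bc_mapD) => -> ->.
by rewrite /= !(bc_actZ, bc_act_in, bc_mapZ, bc_map_in) ehomJ.
Qed.

Definition bc_hom : ehom (bc_mod M) (bc_mod N) := EHom bc_mapJ.

End Hom.

Section Complex.
Variable X : cpx A.

Definition bc_d i j : ehom (bc_mod (X i)) (bc_mod (X j)) :=
  bc_hom (cpx_d X i j).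

Lemma bc_shape i j x : j != i + 1 -> bc_d i j x = 0.
Proof.
move=> nij; elim/ext_ind: x => [|x y IHx IHy|b x]; first exact: raddf0.
  by move: IHx IHy; rewrite /= bc_mapD => -> ->; rewrite addr0.
by rewrite /= bc_mapZ bc_map_in cpx_shape // ext_in0 scaler0.
Qed.

Lemma bc_dd i j l x : bc_d j l (bc_d i j x) = 0.
Proof.
elim/ext_ind: x => [|x y IHx IHy|b x]; first by rewrite /= !bc_map0.
  by move: IHx IHy; rewrite /= !bc_mapD => -> ->; rewrite addr0.
by rewrite /= !bc_mapZ !bc_map_in cpx_dd ext_in0 scaler0.
Qed.

(* The termwise extension of scalars B (x)_A X. *)
Definition base_change : cpx B := Cpx bc_shape bc_dd.

End Complex.

(* Y is (a model of) the derived pullback of X along Spec B -> Spec A: the left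
   derived functor of B (x)_A - is computed on a K-projective resolution. *)
Definition derived_pullback (X : cpx A) (Y : cpx B) : Prop :=
  exists (P : cpx A) (p : cmap P X),
    [/\ Kprojective P, quasi_iso p & derived_iso Y (base_change P)].

End BaseChange.

Lemma triv_gact1 (k : comNzRingType) (a : k) : idfun a = a. Proof. by []. Qed.

(* k with the trivial action: equivariant modules are k-linear
   representations of H. *)
Definition triv_gring (k : comNzRingType) : gring :=
  @MkGRing k (fun=> idfun) (@triv_gact1 k) (fun _ _ => @triv_gact1 k).

Definition trivial_action (A : gring) (X : cpx A) : Prop :=
  forall i h (x : X i), eact h x = x.

End Equivariant.

Section Coinvariant.
Variables (k : fieldType) (H : finGroupType) (n : nat).
Variable rho : mx_representation k [set: H] n.

Local Notation Sym := {mpoly k[n]}.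

(* V is the space of row vectors 'rV[k]_n, with coordinates 'X_j, so that
   {mpoly k[n]} = the symmetric algebra of the dual of V.  In an mx_representation h acts on row vectors by
   v |-> v *m rho h, which is a right action; the left action on V is
   h v = v *m rho h^-1, and the contragredient action on polynomials,
   (h p)(v) = p (h^-1 v), is the substitution of v *m rho h for v. *)
Definition sym_act (h : H) : {rmorphism Sym -> Sym} :=
  comp_mpoly [tuple \sum_(i < n) rho h i j *: 'X_i | j < n].

Lemma sym_actX h j : sym_act h 'X_j = \sum_(i < n) rho h i j *: 'X_i.
Proof. by rewrite /sym_act /= comp_mpolyXU -tnth_nth tnth_mktuple. Qed.

Lemma sym_actZ h c p : sym_act h (c *: p) = c *: sym_act h p.
Proof. exact: comp_mpolyZ. Qed.

Lemma sym_act_eq (u v : {rmorphism Sym -> Sym}) :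
    (forall c, u c%:MP_[n] = v c%:MP_[n]) -> (forall j, u 'X_j = v 'X_j) ->
  forall p, u p = v p.
Proof.
move=> uvC uvX p; rewrite [p](mpolyE p) !rmorph_sum; apply: eq_bigr => m _.
rewrite -mul_mpolyC !rmorphM uvC; congr (_ * _).
rewrite mpolyXE_id !rmorph_prod; apply: eq_bigr => j _.
by rewrite !rmorphXn uvX.
Qed.

Lemma sym_actC h c : sym_act h c%:MP_[n] = c%:MP_[n].
Proof. exact: comp_mpolyC. Qed.

Lemma sym_act1 p : sym_act 1%g p = p.
Proof.
apply: (sym_act_eq (v := idfun)) => [c|j]; first exact: sym_actC.
rewrite sym_actX repr_mx1 (bigD1 j) //= mxE eqxx scale1r big1 ?addr0 // => i.
by rewrite mxE => /negPf->; rewrite scale0r.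
Qed.

Lemma sym_actM g h p : sym_act (g * h)%g p = sym_act g (sym_act h p).
Proof.
apply: (sym_act_eq (v := sym_act g \o sym_act h)) => [c|j] /=.
  by rewrite !sym_actC.
rewrite !sym_actX rmorph_sum repr_mxM ?inE //=.
under [RHS]eq_bigr => i _ do rewrite sym_actZ sym_actX scaler_sumr.
rewrite exchange_big /=; apply: eq_bigr => i _.
rewrite mxE scaler_suml; apply: eq_bigr => l _.
by rewrite scalerA mulrC.
Qed.

Definition homog_invariant (p : Sym^o) : Prop :=
  exists d, [/\ (0 < d)%N, (p : Sym) \is d.-homog & forall h, sym_act h p = p].

(* The ideal generated by the homogeneous invariants of positive degree. *)
Definition coinv_pred : Sym -> bool := span_pred homog_invariant.

Lemma coinv_pred_min (D : Sym -> Prop) :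
    D 0 -> (forall a u v, D u -> D v -> D (a * u + v)) ->
    (forall p, homog_invariant p -> D p) ->
  forall p, p \in coinv_pred -> D p.
Proof. exact: (@span_min Sym Sym^o homog_invariant D). Qed.

Lemma coinv_pred_eval0 p : p \in coinv_pred -> p.@[fun=> 0] = 0.
Proof.
move: p; apply: (coinv_pred_min (D := fun p => p.@[fun=> 0] = 0)).
- by rewrite /= meval0.
- move=> a u v u0 v0; by rewrite mevalD mevalM u0 v0 mulr0 addr0.
move=> p [d [d0 /dhomogP pd _]]; rewrite mevalE big_seq big1 // => m /pd /= md.
suff [i mi] : exists i, m i != 0%N.
  by rewrite (bigD1 i) //= expr0n (negPf mi) mul0r mulr0.
apply/existsP; apply: contraTT d0; rewrite negb_exists => /forallP m0.
by rewrite -md mdegE big1 // => i _; have := m0 i; rewrite negbK => /eqP.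
Qed.

Lemma coinv_idealr_closed : idealr_closed coinv_pred.
Proof.
have [S0 Slin] := span_submod_closed homog_invariant.
split=> //; apply/negP => /coinv_pred_eval0/eqP.
by rewrite meval1 oner_eq0.
Qed.

HB.instance Definition _ := isIdealr.Build Sym coinv_pred coinv_idealr_closed.

Definition coinv_ideal : idealr Sym := Idealr.clone Sym coinv_pred _.

Definition coinvariant : comNzRingType := {ideal_quot coinv_ideal}.

Definition coinv_pi : Sym -> coinvariant := \pi_({ideal_quot coinv_ideal}).

Lemma coinv_pi_surj x : exists p, x = coinv_pi p.
Proof. by exists (repr (x : {ideal_quot coinv_ideal})); rewrite /coinv_pi reprK. Qed.

Lemma coinv_pi_eq p q : (coinv_pi p == coinv_pi q) = (p - q \in coinv_pred).
Proof. by rewrite /coinv_pi piE. Qed.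

Lemma coinv_piB : zmod_morphism coinv_pi.
Proof. by move=> x y; rewrite /coinv_pi raddfB. Qed.

Lemma coinv_piM : monoid_morphism coinv_pi.
Proof. by split=> [|x y]; rewrite /coinv_pi ?rmorph1 ?rmorphM. Qed.

HB.instance Definition _ :=
  GRing.isZmodMorphism.Build Sym coinvariant coinv_pi coinv_piB.
HB.instance Definition _ :=
  GRing.isMonoidMorphism.Build Sym coinvariant coinv_pi coinv_piM.

Section Lift.
Variables (T : comNzRingType) (phi : {rmorphism Sym -> T}).

Definition coinv_lift (_ : forall p, p \in coinv_pred -> phi p = 0) :
  coinvariant -> T := fun x => phi (repr (x : {ideal_quot coinv_ideal})).

Hypothesis phi0 : forall p, p \in coinv_pred -> phi p = 0.

Lemma coinv_lift_pi p : coinv_lift phi0 (coinv_pi p) = phi p.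
Proof.
apply/eqP; rewrite -subr_eq0 -rmorphB /= phi0 // -coinv_pi_eq.
by rewrite /coinv_pi reprK.
Qed.

Lemma coinv_liftB : zmod_morphism (coinv_lift phi0).
Proof.
move=> x y; have [p ->] := coinv_pi_surj x; have [q ->] := coinv_pi_surj y.
by rewrite -rmorphB !coinv_lift_pi rmorphB.
Qed.

Lemma coinv_liftM : monoid_morphism (coinv_lift phi0).
Proof.
split=> [|x y]; first by rewrite -[1](rmorph1 coinv_pi) coinv_lift_pi rmorph1.
have [p ->] := coinv_pi_surj x; have [q ->] := coinv_pi_surj y.
by rewrite -rmorphM !coinv_lift_pi rmorphM.
Qed.

HB.instance Definition _ :=
  GRing.isZmodMorphism.Build coinvariant T (coinv_lift phi0) coinv_liftB.
HB.instance Definition _ :=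
  GRing.isMonoidMorphism.Build coinvariant T (coinv_lift phi0) coinv_liftM.

End Lift.

Lemma coinv_act_subproof h p :
  p \in coinv_pred -> (coinv_pi \o sym_act h) p = 0.
Proof.
have pi0 q : q \in coinv_pred -> coinv_pi q = 0.
  by move=> Iq; apply/eqP; rewrite -(rmorph0 coinv_pi) coinv_pi_eq subr0.
move: p; apply: (coinv_pred_min (D := fun p => (coinv_pi \o sym_act h) p = 0)).
- exact: rmorph0.
- by move=> a u v /= u0 v0; rewrite !(rmorphD, rmorphM) /= u0 v0 mulr0 addr0.
move=> p Gp; have [d [_ _ Hp]] := Gp.
by rewrite /comp Hp; apply/pi0/(@span_gen _ Sym^o).
Qed.

Definition coinv_act (h : H) : {rmorphism coinvariant -> coinvariant} :=
  coinv_lift (@coinv_act_subproof h).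

Lemma coinv_act_pi h p : coinv_act h (coinv_pi p) = coinv_pi (sym_act h p).
Proof. exact: coinv_lift_pi. Qed.

Lemma coinv_act1 x : coinv_act 1%g x = x.
Proof. by have [p ->] := coinv_pi_surj x; rewrite coinv_act_pi sym_act1. Qed.

Lemma coinv_actM g h x : coinv_act (g * h)%g x = coinv_act g (coinv_act h x).
Proof.
by have [p ->] := coinv_pi_surj x; rewrite !coinv_act_pi sym_actM.
Qed.

Definition coinv_gring : gring H := MkGRing coinv_act1 coinv_actM.

(* The structure map k -> C, dual to Spec C -> Spec k. *)
Definition coinv_const : {rmorphism k -> coinvariant} := coinv_pi \o @mpolyC n k.

Lemma coinv_constJ h (c : triv_gring H k) :
  coinv_const (gact (triv_gring H k) h c) = gact coinv_gring h (coinv_const c).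
Proof.
by rewrite [gact coinv_gring h _]coinv_act_pi sym_actC.
Qed.

Definition coinv_struct : ghom (triv_gring H k) coinv_gring :=
  @GHom H (triv_gring H k) coinv_gring coinv_const coinv_constJ.

(* Evaluation at the origin C -> k, dual to the inclusion i of the unique
   closed point of Spec C. *)
Definition coinv_eval0 : {rmorphism coinvariant -> k} :=
  coinv_lift (phi := meval (fun=> 0)) coinv_pred_eval0.

Lemma coinv_eval0_pi p : coinv_eval0 (coinv_pi p) = p.@[fun=> 0].
Proof. exact: coinv_lift_pi. Qed.

Lemma coinv_eval0J h (c : coinv_gring) :
  coinv_eval0 (gact coinv_gring h c) =
  gact (triv_gring H k) h (coinv_eval0 c).
Proof.
have [p ->] := coinv_pi_surj c.
rewrite [gact coinv_gring h _]coinv_act_pi coinv_eval0_pi [RHS]coinv_eval0_pi.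
rewrite comp_mpoly_meval; apply: meval_eq => j; rewrite tnth_mktuple.
by rewrite raddf_sum big1 // => i _; rewrite /= mevalZ mevalXU mulr0.
Qed.

Definition coinv_point : ghom coinv_gring (triv_gring H k) :=
  @GHom H coinv_gring (triv_gring H k) coinv_eval0 coinv_eval0J.

(* F is in the essential image of pullback along Spec(C)/H -> Spec k, which
   factors through Spec(k)/H: a complex of k-vector spaces is given the trivial
   action and then tensored with C, with no need to derive over a field. *)
Definition descends (F : cpx coinv_gring) : Prop :=
  exists W : cpx (triv_gring H k),
    trivial_action W /\ derived_iso F (base_change coinv_struct W).

End Coinvariant.

(* Main.v *)
(* Let P be a K-projective resolution of F, and T = k (x)_C P its derived fibre.

   If F is C (x) W with W trivial, then C (x) W is itself K-projective, because
   an acyclic complex of representations over k is equivariantly contractible;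
   so P is a homotopy retract of C (x) W, and T one of W.

   Conversely, suppose that H acts trivially on the cohomology of T, and let
   W = T^H, so that averaging is a quasi-isomorphism T -> W.  The composite
   P -> T -> W lifts to P -> C (x) W: the kernel of C (x) W -> W has no
   H-invariants, since the average over H of an element of C is a scalar, and
   any map from P to (a shift of) such a complex is null-homotopic, as one sees
   by filtering the target by powers of the nilpotent augmentation ideal m and
   splitting T, equivariantly, into its cohomology and a contractible complex.
   The lift is an isomorphism on derived fibres, so by Nakayama's lemma a
   quasi-isomorphism.  *)
From HB Require Import structures.
From mathcomp Require Import all_boot all_order all_algebra all_fingroup.
From mathcomp Require Import generic_quotient ring_quotient mxrepresentation.
From mathcomp Require Import boolp classical_sets.
From mathcomp.multinomials Require Import mpoly.
Require Import Defs.

Set Implicit Arguments.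
Unset Strict Implicit.
Unset Printing Implicit Defensive.

Import GRing.Theory.
Local Open Scope ring_scope.

(** * Equivariant modules, homotopies and cones *)

(** Of the coinvariant algebra only this enters: equivariant ring maps [eps : C -> k] and
    [s : k -> C] with [eps (s a) = a], and the identity that the sum of the h c over H is the scalar
    [s (#|H|%:R * eps c)], which is the form taken by C^H = k. That identity alone makes the
    augmentation ideal m nilpotent, with m^#|H| = 0.

    The obstacle is that P is unbounded and only K-projective, so nothing can be argued on its
    terms. Information about P is read off from homotopy classes of maps P -> Y. If m kills Y, such
    a map factors through T by adjunction, and a decomposition of the identity of T becomes a
    homotopy; other Y are reached through 0 -> mY -> Y -> Y/mY -> 0. These sequences need not split,
    so exactness for maps out of P is derived from cones, with explicit homotopies in place of a
    triangulated structure.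

    Characteristic zero enters through division by #|H|: in Maschke's theorem, in the nilpotence of
    m, and in the fact that a quotient of a module without invariants has none. *)

Section Homs.
Variables (H : finGroupType) (A : gring H).
Implicit Types M N L : eqmod A.

Lemma eact0 M h : eact h (0 : M) = 0.
Proof. by apply: (addIr (eact h (0 : M))); rewrite -eactD !add0r. Qed.

Lemma eactN M h (x : M) : eact h (- x) = - eact h x.
Proof. by apply: (addIr (eact h x)); rewrite -eactD !addNr eact0. Qed.

Lemma eactB M h (x y : M) : eact h (x - y) = eact h x - eact h y.
Proof. by rewrite eactD eactN. Qed.

Lemma eact_sum M h I (r : seq I) P (F : I -> M) :
  eact h (\sum_(i <- r | P i) F i) = \sum_(i <- r | P i) eact h (F i).
Proof. exact: (big_morph _ (eactD h) (eact0 M h)). Qed.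

Lemma ehom0 M N (f : ehom M N) : f 0 = 0. Proof. exact: raddf0. Qed.
Lemma ehomN M N (f : ehom M N) x : f (- x) = - f x.
Proof. exact: raddfN. Qed.
Lemma ehomD M N (f : ehom M N) x y : f (x + y) = f x + f y.
Proof. exact: raddfD. Qed.
Lemma ehomB M N (f : ehom M N) x y : f (x - y) = f x - f y.
Proof. exact: raddfB. Qed.
Lemma ehomZ M N (f : ehom M N) a x : f (a *: x) = a *: f x.
Proof. exact: linearZ. Qed.

Definition mk_ehom M N (f : M -> N) (fl : linear f)
    (fJ : forall h x, f (eact h x) = eact h (f x)) : ehom M N :=
  @EHom H A M N (HB.pack f (GRing.isLinear.Build A M N *:%R f fl)) fJ.

Lemma ezero_linear M N : linear (fun _ : M => 0 : N).
Proof. by move=> a x y; rewrite scaler0 addr0. Qed.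
Lemma ezeroJ M N h (x : M) : (fun _ : M => 0 : N) (eact h x) = eact h 0.
Proof. by rewrite eact0. Qed.
Definition ezero M N : ehom M N := mk_ehom (@ezero_linear M N) (@ezeroJ M N).

Definition eid M : ehom M M :=
  @mk_ehom M M (fun x => x) (fun _ _ _ => erefl) (fun _ _ => erefl).

Lemma ecomp_linear M N L (g : ehom N L) (f : ehom M N) :
  linear (fun x => g (f x)).
Proof. by move=> a x y; rewrite !linearP. Qed.
Lemma ecompJ M N L (g : ehom N L) (f : ehom M N) h x :
  g (f (eact h x)) = eact h (g (f x)).
Proof. by rewrite !ehomJ. Qed.
Definition ecomp M N L (g : ehom N L) (f : ehom M N) : ehom M L :=
  mk_ehom (ecomp_linear g f) (ecompJ g f).

Lemma eadd_linear M N (f g : ehom M N) : linear (fun x => f x + g x).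
Proof. by move=> a x y; rewrite !linearP scalerDr addrACA. Qed.
Lemma eaddJ M N (f g : ehom M N) h x :
  f (eact h x) + g (eact h x) = eact h (f x + g x).
Proof. by rewrite !ehomJ eactD. Qed.
Definition eadd M N (f g : ehom M N) : ehom M N :=
  mk_ehom (eadd_linear f g) (eaddJ f g).

Lemma eopp_linear M N (f : ehom M N) : linear (fun x => - f x).
Proof. by move=> a x y; rewrite linearP opprD scalerN. Qed.
Lemma eoppJ M N (f : ehom M N) h x : - f (eact h x) = eact h (- f x).
Proof. by rewrite ehomJ eactN. Qed.
Definition eopp M N (f : ehom M N) : ehom M N :=
  mk_ehom (eopp_linear f) (eoppJ f).

Section Pair.
Variables M N : eqmod A.
Definition pair_act h (z : M * N) : M * N := (eact h z.1, eact h z.2).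
Lemma pair_actD h : {morph pair_act h : x y / x + y}.
Proof. by move=> x y; rewrite /pair_act !eactD. Qed.
Lemma pair_actZ h a x : pair_act h (a *: x) = gact A h a *: pair_act h x.
Proof. by rewrite /pair_act !eactZ. Qed.
Lemma pair_act1 x : pair_act 1%g x = x.
Proof. by rewrite /pair_act !eact1 -surjective_pairing. Qed.
Lemma pair_actM g h x : pair_act (g * h)%g x = pair_act g (pair_act h x).
Proof. by rewrite /pair_act !eactM. Qed.
Definition epair : eqmod A := EqMod pair_actD pair_actZ pair_act1 pair_actM.

Definition efst : ehom epair M :=
  @mk_ehom epair M (fun z => z.1) (fun _ _ _ => erefl) (fun _ _ => erefl).
Definition esnd : ehom epair N :=
  @mk_ehom epair N (fun z => z.2) (fun _ _ _ => erefl) (fun _ _ => erefl).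
End Pair.

Lemma epairing_linear M N L (f : ehom L M) (g : ehom L N) :
  linear (fun x => (f x, g x) : epair M N).
Proof. by move=> a x y; rewrite !linearP. Qed.
Lemma epairingJ M N L (f : ehom L M) (g : ehom L N) h x :
  (f (eact h x), g (eact h x)) = eact h ((f x, g x) : epair M N).
Proof. by rewrite !ehomJ. Qed.
Definition epairing M N L (f : ehom L M) (g : ehom L N) : ehom L (epair M N) :=
  mk_ehom (epairing_linear f g) (epairingJ f g).

(* The identity when i = j, and zero otherwise: it moves elements between
   components whose indices are equal but not convertible. *)
Definition hcast (X : int -> eqmod A) i j : ehom (X i) (X j) :=
  match @eqP _ i j with
  | ReflectT e => eq_rect i (fun j => ehom (X i) (X j)) (eid (X i)) j e
  | ReflectF _ => ezero (X i) (X j)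
  end.

Lemma hcast_id (X : int -> eqmod A) i (x : X i) : hcast X i i x = x.
Proof.
by rewrite /hcast; case: eqP => // e; rewrite (eq_axiomK e).
Qed.

Lemma hcast_neq (X : int -> eqmod A) i j (x : X i) : i != j -> hcast X i j x =
  0.
Proof. by rewrite /hcast; case: eqP. Qed.

End Homs.

Section Homotopy.
Variables (H : finGroupType) (A : gring H).
Implicit Types X Y Z P : cpx A.

Lemma cocycleP X i j (x : X i) : cocycle x -> cpx_d X i j x = 0.
Proof. by case: (eqVneq j (i + 1)) => [->|/cpx_shape ->]. Qed.

(** Trades i - 1 for any p with p + 1 = i; after [subst] the two degrees are p and p + 1, and no
    transport between (i - 1) + 1 and i is left. *)
Lemma coboundaryP X p i (x : X i) : p + 1 = i ->
  coboundary x <-> exists y : X p, x = cpx_d X p i y.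
Proof. by move=> pi; have <- : i - 1 = p by rewrite -pi addrK. Qed.

Lemma coboundary_d X p i (y : X p) : coboundary (cpx_d X p i y).
Proof.
case: (eqVneq i (p + 1)) => [e|/cpx_shape ->].
  by apply/(coboundaryP _ (esym e)); exists y.
by exists 0; rewrite ehom0.
Qed.

Lemma coboundary0 X i : coboundary (0 : X i).
Proof. by exists 0; rewrite ehom0. Qed.

Lemma coboundaryD X i (x y : X i) :
  coboundary x -> coboundary y -> coboundary (x + y).
Proof. by move=> [a ->] [b ->]; exists (a + b); rewrite ehomD. Qed.

Lemma coboundaryN X i (x : X i) : coboundary x -> coboundary (- x).
Proof. by move=> [a ->]; exists (- a); rewrite ehomN. Qed.

Lemma coboundaryB X i (x y : X i) :
  coboundary x -> coboundary y -> coboundary (x - y).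
Proof. by move=> ? /coboundaryN; apply: coboundaryD. Qed.

Lemma coboundary_map X Y (f : cmap X Y) i (x : X i) :
  coboundary x -> coboundary (f i x).
Proof. by move=> [y ->]; rewrite cmapD; apply: coboundary_d. Qed.

Lemma cocycle_coboundary X i (x : X i) : coboundary x -> cocycle x.
Proof. by move=> [y ->]; rewrite /cocycle cpx_dd. Qed.

Lemma cocycleB X i (x y : X i) : cocycle x -> cocycle y -> cocycle (x - y).
Proof. by move=> cx cy; rewrite /cocycle ehomB /= !cocycleP ?subrr. Qed.

Lemma cocycle_map X Y (f : cmap X Y) i (x : X i) : cocycle x -> cocycle (f i x).
Proof. by move=> cx; rewrite /cocycle -cmapD (cocycleP _ cx) ehom0. Qed.

Lemma cocycle_act X i (x : X i) h : cocycle x -> cocycle (eact h x).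
Proof. by move=> cx; rewrite /cocycle ehomJ (cocycleP _ cx) eact0. Qed.

Lemma coboundary_act X i (x : X i) h : coboundary x -> coboundary (eact h x).
Proof. by move=> [y ->]; rewrite -ehomJ; apply: coboundary_d. Qed.

(** Takes a bare family of functions instead of a [cmap], so that differences and composites can be
    called null-homotopic without being packaged as chain maps. *)
Definition nullh X Y (f : forall i, X i -> Y i) : Prop :=
  exists s : forall i j, ehom (X i) (Y j), forall i (x : X i),
    f i x = cpx_d Y (i - 1) i (s i (i - 1) x) + s (i + 1) i (cpx_d X i (i + 1)
      x).

Lemma nullhP X Y (f : forall i, X i -> Y i) : nullh f <->
  exists s : forall i j, ehom (X i) (Y j),
    forall p i q (x : X i), p + 1 = i -> i + 1 = q ->
    f i x = cpx_d Y p i (s i p x) + s q i (cpx_d X i q x).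
Proof.
split=> -[s sE]; exists s; last by move=> i x; apply: sE; rewrite ?subrK.
move=> p i q x pi <-; by rewrite sE; have -> : i - 1 = p by rewrite -pi addrK.
Qed.

Lemma eq_nullh X Y (f g : forall i, X i -> Y i) :
  (forall i x, f i x = g i x) -> nullh f -> nullh g.
Proof. by move=> fg [s sE]; exists s => i x; rewrite -fg. Qed.

Lemma nullh0 X Y : nullh (fun i (_ : X i) => 0 : Y i).
Proof. by exists (fun i j => ezero (X i) (Y j)) => i x /=;
  rewrite ehom0 addr0. Qed.

Lemma nullhD X Y (f g : forall i, X i -> Y i) :
  nullh f -> nullh g -> nullh (fun i x => f i x + g i x).
Proof.
move=> [s sE] [t tE]; exists (fun i j => eadd (s i j) (t i j)) => i x /=.
by rewrite sE tE ehomD addrACA.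
Qed.

Lemma nullhN X Y (f : forall i, X i -> Y i) :
  nullh f -> nullh (fun i x => - f i x).
Proof.
move=> [s sE]; exists (fun i j => eopp (s i j)) => i x /=.
by rewrite sE ehomN opprD.
Qed.

Lemma nullhB X Y (f g : forall i, X i -> Y i) :
  nullh f -> nullh g -> nullh (fun i x => f i x - g i x).
Proof. by move=> nf /nullhN ng; apply: nullhD. Qed.

Lemma nullh_compl X Y Z (g : cmap Y Z) (f : forall i, X i -> Y i) :
  nullh f -> nullh (fun i x => g i (f i x)).
Proof.
move=> [s sE]; exists (fun i j => ecomp (g j) (s i j)) => i x /=.
by rewrite sE ehomD /= cmapD.
Qed.

Lemma nullh_compr X Y Z (f : forall i, Y i -> Z i) (g : cmap X Y) :
  nullh f -> nullh (fun i x => f i (g i x)).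
Proof.
move=> [s sE]; exists (fun i j => ecomp (s i j) (g i)) => i x /=.
by rewrite sE cmapD.
Qed.

Lemma nullh_coboundary X Y (f : forall i, X i -> Y i) i (x : X i) :
  nullh f -> cocycle x -> coboundary (f i x).
Proof.
move=> [s sE] cx; rewrite sE (cocycleP _ cx) ehom0 addr0.
exact: coboundary_d.
Qed.

Lemma nullh_id_acyclic X : nullh (fun i (x : X i) => x) -> acyclic X.
Proof. by move=> Xn i x; apply: (nullh_coboundary Xn). Qed.

Lemma ccompP X Y Z (g : cmap Y Z) (f : cmap X Y) i j x :
  ecomp (g j) (f j) (cpx_d X i j x) = cpx_d Z i j (ecomp (g i) (f i) x).
Proof. by rewrite /= !cmapD. Qed.
Definition ccomp X Y Z (g : cmap Y Z) (f : cmap X Y) : cmap X Z :=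
  CMap (@ccompP X Y Z g f).

Lemma csubP X Y (f g : cmap X Y) i j x :
  eadd (f j) (eopp (g j)) (cpx_d X i j x) =
  cpx_d Y i j (eadd (f i) (eopp (g i)) x).
Proof. by rewrite /= !cmapD ehomB. Qed.
Definition csub X Y (f g : cmap X Y) : cmap X Y := CMap (@csubP X Y f g).

Definition cmap_id X : cmap X X := @CMap H A X X (fun i => eid (X i)) (fun _ _
  _ => erefl).

(* The differential of X[m] is negated, as is right for odd m; only m = 1 and
   m = -1 are used. *)
Section Shift.
Variables (X : cpx A) (m : int).
Definition shift_d i j : ehom (X (i + m)) (X (j + m)) :=
  eopp (cpx_d X (i + m) (j + m)).
Lemma shift_shape i j x : j != i + 1 -> shift_d i j x = 0.
Proof.
move=> nij; rewrite /= cpx_shape ?oppr0 // addrAC.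
by apply: contraNneq nij => /addIr->.
Qed.
Lemma shift_dd i j l x : shift_d j l (shift_d i j x) = 0.
Proof. by rewrite /= ehomN /= cpx_dd !oppr0. Qed.
Definition shift : cpx A := @Cpx H A (fun i => X (i + m)) shift_d shift_shape
  shift_dd.

Lemma acyclic_shift : acyclic X -> acyclic shift.
Proof.
move=> acX i x cx; have /(acX _ x) : @cocycle _ _ X (i + m) x.
  by move: cx; rewrite /cocycle /= addrAC => /eqP; rewrite oppr_eq0 => /eqP.
move/(@coboundaryP X (i - 1 + m)) => [|y xE]; first by rewrite addrAC subrK.
by exists (- y); rewrite /= ehomN opprK /=.
Qed.
End Shift.

Section Cone.
Variables (X Y : cpx A) (f : cmap X Y).

(** The cone differential needs a component X (i + 1) -> Y j for every pair of degrees; the cast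
    makes it f when j = i + 1 and zero otherwise. *)
Definition ccast i j : ehom (X i) (Y j) := ecomp (hcast Y i j) (f i).

Lemma ccast_neq i j x : i != j -> ccast i j x = 0.
Proof. exact: hcast_neq. Qed.

Definition cone_obj i : eqmod A := epair (X (i + 1)) (Y i).
Definition cone_d i j : ehom (cone_obj i) (cone_obj j) :=
  epairing (ecomp (eopp (cpx_d X (i + 1) (j + 1))) (efst _ _))
           (eadd (ecomp (ccast (i + 1) j) (efst _ _))
                 (ecomp (cpx_d Y i j) (esnd _ _))).

Lemma cone_dE i j z : cone_d i j z =
  (- cpx_d X (i + 1) (j + 1) z.1, ccast (i + 1) j z.1 + cpx_d Y i j z.2).
Proof. by []. Qed.

Lemma cone_shape i j z : j != i + 1 -> cone_d i j z = 0.
Proof.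
move=> nij; rewrite cone_dE ccast_neq 1?eq_sym // !cpx_shape //.
  by rewrite oppr0 addr0.
by apply: contraNneq nij => /addIr->.
Qed.

Lemma cone_dd i j l z : cone_d j l (cone_d i j z) = 0.
Proof.
case: (eqVneq l (j + 1)) => [->|/cone_shape->//].
case: (eqVneq j (i + 1)) => [->|/(cone_shape z)->]; last by rewrite ehom0.
rewrite !cone_dE /= !ehomN cpx_dd ehomD /= cpx_dd addr0 !oppr0.
by rewrite !hcast_id cmapD addNr.
Qed.

Definition cone : cpx A := Cpx cone_shape cone_dd.

Lemma cone_acyclic : quasi_iso f -> acyclic cone.
Proof.
move=> qf i [x y]; rewrite /cocycle [cpx_d _ _ _]/(cone_d _ _) cone_dE /= =>
  -[].
move/eqP; rewrite oppr_eq0 => /eqP dx; rewrite hcast_id => fx.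
have [inj _] := qf (i + 1); have {inj} : coboundary x.
  apply: inj => //; apply/(coboundaryP _ (erefl (i + 1))); exists (- y).
  by rewrite ehomN; apply/eqP; rewrite -addr_eq0 fx.
move=> /(coboundaryP _ (erefl (i + 1)))[x' xE].
have cy : cocycle (y + f i x').
  by rewrite /cocycle ehomD -cmapD -xE [LHS]addrC.
have [_ /(_ _ cy)[x'' [cx'' /(coboundaryP _ (subrK 1 i))[y' y'E]]]] := qf i.
have [p pi] : exists p, p + 1 = i by exists (i - 1); rewrite subrK.
subst i; apply/(@coboundaryP cone p) => //.
have e : p + 1 - 1 = p by rewrite addrK.
(* From x = d x' and y + f x' = f x'' + d y' one gets y = f (x'' - x') + d y', while - d (x'' - x')
   = x. The cast only moves y' to degree p. *)
exists ((x'' - x' : X (p + 1)), (hcast Y _ _ y' : Y p)).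
rewrite [cpx_d _ _ _]/(cone_d _ _) cone_dE /= hcast_id.
rewrite ehomB /= (cocycleP _ cx'') sub0r opprK -xE; congr pair.
suff -> : cpx_d Y p (p + 1) (hcast Y (p + 1 - 1) p y') =
   cpx_d Y (p + 1 - 1) (p + 1) y'.
  by rewrite -y'E ehomB [RHS]addrC addrA subrK addrK.
by move: (p + 1 - 1) e y' {y'E} => _ -> y'; rewrite hcast_id.
Qed.

Lemma cone_acyclic_quasi_iso : acyclic cone -> quasi_iso f.
Proof.
move=> ac i; split=> [x cx|y cy].
  have [p pi] : exists p, p + 1 = i by exists (i - 1); rewrite subrK.
  subst i => /(coboundaryP _ (erefl (p + 1)))[y fx].
  have /ac[[a b]] : @cocycle _ _ cone p (x, - y).
    rewrite /cocycle [cpx_d _ _ _]/(cone_d _ _) cone_dE /= (cocycleP _ cx).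
    by rewrite hcast_id fx ehomN oppr0 subrr.
  rewrite [cpx_d _ _ _]/(cone_d _ _) cone_dE /= => -[-> _].
  exact/coboundaryN/coboundary_d.
have [p pi] : exists p, p + 1 = i by exists (i - 1); rewrite subrK.
subst i; have /ac/(@coboundaryP cone p)[//|[a b]] : @cocycle _ _ cone _ (0, y).
  rewrite /cocycle [cpx_d _ _ _]/(cone_d _ _) cone_dE /= !ehom0 add0r.
  by rewrite oppr0 cy.
rewrite [cpx_d _ _ _]/(cone_d _ _) cone_dE /= hcast_id => -[da ->].
exists a; split; last by rewrite addrAC subrr add0r; apply: coboundary_d.
by apply/eqP; rewrite /cocycle -oppr_eq0 -da.
Qed.

(** A null-homotopy of (0, p) has components a and b. Its X-component says that a commutes with the
    differentials, hence is the lift l; its Y-component says that b is a homotopy between p and f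
    l. *)
Lemma cone_lift P (p : cmap P Y) :
    nullh (fun i (x : P i) => (0, p i x) : cone i) ->
  exists l : cmap P X, nullh (fun i x => f i (l i x) - p i x).
Proof.
move=> /nullhP[s sE].
pose a i j : ehom (P i) (X (j + 1)) := ecomp (efst _ _) (s i j).
pose b i j : ehom (P i) (Y j) := ecomp (esnd _ _) (s i j).
pose l i := ecomp (hcast X (i - 1 + 1) i) (a i (i - 1)).
have lE q x : l (q + 1) x = a (q + 1) q x.
  rewrite /l /=; have -> : q + 1 - 1 = q by rewrite addrK.
  by rewrite hcast_id.
have lD i j x : l j (cpx_d P i j x) = cpx_d X i j (l i x).
  case: (eqVneq j (i + 1)) => [->|nij]; last by rewrite !cpx_shape // ehom0.
  have [q qi] : exists q, q + 1 = i by exists (i - 1); rewrite subrK.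
  subst i; rewrite !lE.
  have := sE q _ _ x erefl erefl; rewrite [cpx_d cone _ _]/(cone_d _ _).
  rewrite cone_dE [s _ (q + 1) _]surjective_pairing => -[/eqP + _].
  by rewrite eq_sym [- _ + _]addrC subr_eq0 => /eqP.
exists (CMap lD); apply: eq_nullh (fun i x => - (p i x - f i (l i x))) _ _ _.
  by move=> i x /=; rewrite opprB.
apply/nullhN/nullhP; exists b => q i r x qi ir; subst i r.
have := sE q _ _ x erefl erefl; rewrite [cpx_d cone _ _]/(cone_d _ _).
rewrite cone_dE [s _ (q + 1) _]surjective_pairing => -[_].
by rewrite hcast_id => ->; rewrite lE; apply/eqP;
  rewrite subr_eq [eqbRHS]addrC addrA.
Qed.

End Cone.
End Homotopy.

(** * Maps out of K-projective complexes *)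

Section KProjective.
Variables (H : finGroupType) (A : gring H).
Implicit Types X Y Z P Q N : cpx A.

Lemma Kprojective_lift P Z F (q : cmap Z F) (p : cmap P F) :
    Kprojective P -> quasi_iso q ->
  exists l : cmap P Z, nullh (fun i x => q i (l i x) - p i x).
Proof.
move=> KP qq; apply: cone_lift.
pose g i : ehom (P i) (cone q i) := epairing (ezero _ _) (p i).
have gD i j x : g j (cpx_d P i j x) = cpx_d (cone q) i j (g i x).
  rewrite [RHS](cone_dE q) /= !ehom0 oppr0 add0r.
  by rewrite cmapD.
exact: (KP _ (CMap gD) (cone_acyclic qq)).
Qed.

(** A map P[1] -> Y amounts to a map P -> Y[-1], whose target is again acyclic. *)
Lemma Kprojective_shift P : Kprojective P -> Kprojective (shift P 1).
Proof.
move=> KP Y f acY.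
pose g i : ehom (P i) (shift Y (-1) i) :=
  ecomp (f (i - 1)) (hcast P i (i - 1 + 1)).
have gD i j x : g j (cpx_d P i j x) = cpx_d (shift Y (-1)) i j (g i x).
  rewrite /g /= -(@cmapD _ _ _ _ f (i - 1) (j - 1)) -ehomN.
  congr (f _ _).
  have [p pi] : exists p, p + 1 = i by exists (i - 1); rewrite subrK.
  have [q qj] : exists q, q + 1 = j by exists (j - 1); rewrite subrK.
  by subst i j; rewrite !addrK !hcast_id opprK.
have /nullhP[s sE] := KP _ (CMap gD) (acyclic_shift acY).
(* The differentials of P[1] and Y[-1] are the negatives of those of P and Y, so the homotopy
   changes sign. *)
pose t i j : ehom (shift P 1 i) (Y j) :=
  eopp (ecomp (hcast Y (j + 1 - 1) j) (s (i + 1) (j + 1))).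
apply/nullhP; exists t => p i q x pi iq; subst i q.
have := sE (p + 1) _ _ x erefl erefl; rewrite /t /g /=.
rewrite !ehomN opprK.
move: (s (p + 1 + 1) (p + 1) x : Y (p + 1 - 1)).
move: (s (p + 1 + 1 + 1) (p + 1 + 1) _ : Y (p + 1 + 1 - 1)) => b a.
by move: a b; rewrite !addrK => a b; rewrite !hcast_id.
Qed.

(** Uniqueness of lifts up to homotopy. A null-homotopy s of q l makes (l, - s) a chain map from
    P[1] to the acyclic cone of q; the Z-component of a null-homotopy of that map is, up to sign,
    one of l. *)
Lemma Kprojective_lift_null P Z F (q : cmap Z F) (l : cmap P Z) :
    Kprojective P -> quasi_iso q ->
  nullh (fun i x => q i (l i x)) -> nullh (fun i x => l i x).
Proof.
move=> KP qq /nullhP[s sE].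
pose g i : ehom (shift P 1 i) (cone q i) :=
  epairing (l (i + 1)) (eopp (s (i + 1) i)).
have gD i j x : g j (cpx_d (shift P 1) i j x) = cpx_d (cone q) i j (g i x).
  case: (eqVneq j (i + 1)) => [->|nij]; last by rewrite !cpx_shape // ehom0.
  rewrite [RHS](cone_dE q) /= hcast_id !ehomN cmapD; congr pair.
  rewrite opprK (sE _ _ _ _ erefl erefl).
  by rewrite [RHS]addrAC subrr add0r.
have /nullhP[t tE] :=
  Kprojective_shift KP (CMap gD) (cone_acyclic qq).
have [a aE] : exists a : forall i j, ehom (P (i + 1)) (Z (j + 1)),
    forall i j x, a i j x = (t i j x).1.
  by exists (fun i j => ecomp (efst _ _) (t i j)).
pose u i j : ehom (P i) (Z j) :=
  eopp (ecomp (hcast Z (j - 1 + 1) j)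
    (ecomp (a (i - 1) (j - 1)) (hcast P i (i - 1 + 1)))).
have uE i j x : u (i + 1) (j + 1) x = - a i j x by rewrite /u /= !(addrK 1)
  !hcast_id.
apply/nullhP; exists u => p i r x pi ir; subst i r.
have [p' p'E] : exists p', p' + 1 = p by exists (p - 1); rewrite subrK.
subst p; have := tE p' _ _ x erefl erefl.
rewrite [cpx_d (cone q) _ _ _](cone_dE q) [t _ (p' + 1) _]surjective_pairing.
by move=> -[-> _]; rewrite -!aE !uE !ehomN.
Qed.

(** The cone is built from Y and X[1]. A null-homotopy s of g on Y corrects g on X[1] by s f to a
    chain map g1, and a null-homotopy of g1 combines with s to one of g. *)
Lemma Kprojective_cone X Y (f : cmap X Y) :
  Kprojective X -> Kprojective Y -> Kprojective (cone f).
Proof.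
move=> KX KY Z g acZ.
pose g2 i : ehom (Y i) (Z i) := ecomp (g i) (epairing (ezero _ _) (eid _)).
have g2D i j x : g2 j (cpx_d Y i j x) = cpx_d Z i j (g2 i x).
  rewrite /= -(cmapD g j); congr (g j _).
  by rewrite [RHS](cone_dE f) /= !ehom0 oppr0 add0r.
have /nullhP[s sE] := KY _ (CMap g2D) acZ.
pose g1 i : ehom (shift X 1 i) (Z i) :=
  eadd (ecomp (g i) (epairing (eid _) (ezero _ _)))
       (eopp (ecomp (s (i + 1) i) (f (i + 1)))).
have g1D i j x : g1 j (cpx_d (shift X 1) i j x) = cpx_d Z i j (g1 i x).
  case: (eqVneq j (i + 1)) => [->|nij]; last by rewrite !cpx_shape // ehom0.
  rewrite /= ehomB -(cmapD g) [cpx_d (cone f) _ _ _](cone_dE f) /= hcast_id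
    ehom0 addr0.
  have := sE _ _ _ (f _ x) (erefl (i + 1)) erefl; rewrite /= => sfx.
  rewrite !ehomN opprK cmapD; apply/eqP; rewrite eq_sym subr_eq -[eqbRHS]addrA
    [s _ _ _ + _]addrC -sfx.
  rewrite -(ehomD (g (i + 1))); apply/eqP; congr (g _ _).
  by congr pair; rewrite /= ?addr0 ?add0r.
have /nullhP[t tE] := Kprojective_shift KX (CMap g1D) acZ.
pose u i j : ehom (cone f i) (Z j) :=
  eadd (ecomp (t i j) (efst _ _)) (ecomp (s i j) (esnd _ _)).
apply/nullhP; exists u => p i q [x y] pi iq.
have -> : g i (x, y) = g1 i x + s (i + 1) i (f (i + 1) x) + g2 i y.
  rewrite /= subrK -(ehomD (g i)); congr (g i _).
  by congr pair; rewrite /= ?addr0 ?add0r.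
have := tE p i q x pi iq; have := sE p i q y pi iq; rewrite /= => -> ->.
subst i q; rewrite hcast_id !ehomD.
have shuffle (a b c d e : Z (p + 1)) : a + b + c + (d + e) =
  a + d + (b + (c + e)).
  by rewrite -!addrA; congr (_ + _); rewrite [RHS]addrCA; congr (_ + _);
    exact: addrCA.
exact: shuffle.
Qed.

Section Exact.
Variables (N Y Z : cpx A) (u : cmap N Y) (v : cmap Y Z).
Hypothesis u_inj : forall i (n : N i), u i n = 0 -> n = 0.
Hypothesis v_surj : forall i (z : Z i), exists y, z = v i y.
Hypothesis vu0 : forall i n, v i (u i n) = 0.
Hypothesis exactY : forall i (y : Y i), v i y = 0 -> exists n, y = u i n.

Lemma cone_projD i j x :
  ecomp (v j) (esnd _ _) (cpx_d (cone u) i j x) =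
  cpx_d Z i j (ecomp (v i) (esnd _ _) x).
Proof.
rewrite (cone_dE u) /= ehomD cmapD.
case: (eqVneq (i + 1) j) => [<-|nij]; first by rewrite hcast_id vu0 add0r.
by rewrite hcast_neq // ehom0 add0r.
Qed.
Definition cone_proj : cmap (cone u) Z := CMap cone_projD.

(** The sequence 0 -> N -> Y -> Z -> 0 need not split; this lets the cone of u stand in for Z, and
    maps into the cone have components in N and Y. *)
Lemma cone_proj_quasi_iso : quasi_iso cone_proj.
Proof.
move=> i; split.
  move=> [n y]; rewrite /cocycle [cpx_d _ _ _ _](cone_dE u) /= hcast_id => -[_
    dy].
  have [p pi] : exists p, p + 1 = i by exists (i - 1); rewrite subrK.
  subst i => /(coboundaryP _ (erefl (p + 1)))[z]; have [y' ->] := v_surj z.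
  rewrite -cmapD => /eqP; rewrite -subr_eq0 -ehomB => /eqP /exactY[n' yE].
  apply/(@coboundaryP _ _ (cone u) p) => //; exists (n', y').
  rewrite [cpx_d _ _ _ _](cone_dE u) /= hcast_id -yE subrK; congr pair.
  apply/eqP; rewrite -addr_eq0; apply/eqP/u_inj.
  by rewrite ehomD cmapD -yE ehomB cpx_dd subr0.
move=> z cz; have [y zE] := v_surj z; subst z.
have [n dy] : exists n, cpx_d Y i (i + 1) y = u _ n by apply: exactY;
  rewrite cmapD.
(* Since d y = u n, the second component of the differential of (- n, y) vanishes; the first is d n,
   which is zero because u is injective. *)
exists (- n, y); split; last by rewrite /= subrr; apply: coboundary0.
rewrite /cocycle [cpx_d _ _ _ _](cone_dE u) /= hcast_id dy !ehomN addNr opprK.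
by congr pair; apply: u_inj; rewrite cmapD -dy cpx_dd.
Qed.

(** By uniqueness of lifts along [cone_proj], the map (0, f) into the cone of u is null-homotopic as
    soon as v f is; [cone_lift] then factors f through u. *)
Lemma exact_mid P (f : cmap P Y) :
    Kprojective P -> nullh (fun i x => v i (f i x)) ->
  exists l : cmap P N, nullh (fun i x => u i (l i x) - f i x).
Proof.
move=> KP vf; apply: cone_lift.
pose g i : ehom (P i) (cone u i) := epairing (ezero _ _) (f i).
have gD i j x : g j (cpx_d P i j x) = cpx_d (cone u) i j (g i x).
  by rewrite [RHS](cone_dE u) /= !ehom0 oppr0 add0r cmapD.
exact: (Kprojective_lift_null (l := CMap gD) KP cone_proj_quasi_iso).
Qed.

(** Lift f to (n, y) in the cone of u. Then n is a chain map P -> N[1], the obstruction, and y fails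
    to commute with the differentials exactly by u n. *)
Lemma exact_lift P (f : cmap P Z) :
    Kprojective P -> (forall l : cmap P (shift N 1), nullh (fun i x => l i x))
      ->
  exists l : cmap P Y, nullh (fun i x => v i (l i x) - f i x).
Proof.
move=> KP PN; have [g gE] := Kprojective_lift f KP cone_proj_quasi_iso.
pose n i : ehom (P i) (shift N 1 i) := ecomp (efst _ _) (g i).
pose y i : ehom (P i) (Y i) := ecomp (esnd _ _) (g i).
have gD i j x : n j (cpx_d P i j x) = - cpx_d N (i + 1) (j + 1) (n i x) /\ y j
  (cpx_d P i j x) = hcast Y (i + 1) j (u (i + 1) (n i x)) + cpx_d Y i j (y i x).
  by rewrite /n /y /= (cmapD g).
have nD i j x : n j (cpx_d P i j x) = cpx_d (shift N 1) i j (n i x).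
  by have [] := gD i j x.
have [h hE] : exists h : forall i j, ehom (P i) (N (j + 1)), forall p x,
    n (p + 1) x = - cpx_d N (p + 1) (p + 1 + 1) (h (p + 1) p x)
                  + h (p + 1 + 1) (p + 1) (cpx_d P (p + 1) (p + 1 + 1) x).
  have /nullhP[h hE] := PN (CMap nD).
  by exists h => p x; exact: (hE p _ _ x erefl erefl).
pose k i : ehom (P i) (N i) := ecomp (hcast N (i - 1 + 1) i) (h i (i - 1)).
have kE p x : k (p + 1) x = h (p + 1) p x by rewrite /k /= (addrK 1) hcast_id.
(* Subtracting u k, where k comes from the null-homotopy of n, turns y into a chain map without
   changing its image in Z. *)
pose l i : ehom (P i) (Y i) := eadd (y i) (eopp (ecomp (u i) (k i))).
have lD i j x : l j (cpx_d P i j x) = cpx_d Y i j (l i x).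
  case: (eqVneq j (i + 1)) => [->|nij]; last by rewrite !cpx_shape // ehom0.
  have [p pi] : exists p, p + 1 = i by exists (i - 1); rewrite subrK.
  subst i; have [_ yd] := gD (p + 1) (p + 1 + 1) x.
  have lE r z : l r z = y r z - u r (k r z) by [].
  rewrite !lE yd hcast_id !kE hE ehomB -cmapD ehomD ehomN.
  by rewrite [LHS]addrAC addrK [LHS]addrC.
exists (CMap lD); apply: eq_nullh gE => i x /=.
by rewrite ehomB vu0 subr0.
Qed.

End Exact.
End KProjective.

(** * Submodules, quotients and change of rings *)

Section SubQuotient.
Variables (H : finGroupType) (A : gring H) (M : eqmod A) (G : M -> Prop).
Hypothesis GJ : forall h x, G x -> G (eact h x).

Lemma span_act h x : x \in span_pred G -> eact h x \in span_pred G.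
Proof.
have [S0 Slin] := span_submod_closed G; move: x.
apply: (span_min (D := fun x => eact h x \in span_pred G)).
- by rewrite eact0.
- by move=> a u v; rewrite eactD eactZ; apply: Slin.
by move=> x Gx; apply/span_gen/GJ.
Qed.

HB.instance Definition _ :=
  GRing.isScaleClosed.Build A M (span_pred G) (fun a x => @span_scale A M G a
    x).

(** A submodule is spanned by an H-stable predicate that need not be closed under sums: mY will be
    generated by the products c y. For kernels and invariants the span adds nothing. *)
Inductive submod : predArgType := Submod x & x \in span_pred G.
Definition submod_val u := let: Submod x _ := u in x.
HB.instance Definition _ := [isSub for submod_val].
HB.instance Definition _ := [Choice of submod by <:].
HB.instance Definition _ := [SubChoice_isSubLmodule of submod by <:].

Definition sub_act h (u : submod) : submod := Submod (span_act h (valP u)).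

Lemma sub_actD h : {morph sub_act h : x y / x + y}.
Proof. by move=> x y; apply: val_inj; rewrite /= eactD. Qed.
Lemma sub_actZ h a x : sub_act h (a *: x) = gact A h a *: sub_act h x.
Proof. by apply: val_inj; rewrite /= eactZ. Qed.
Lemma sub_act1 x : sub_act 1%g x = x.
Proof. by apply: val_inj; rewrite /= eact1. Qed.
Lemma sub_actM g h x : sub_act (g * h)%g x = sub_act g (sub_act h x).
Proof. by apply: val_inj; rewrite /= eactM. Qed.

Definition sub_eqmod : eqmod A := EqMod sub_actD sub_actZ sub_act1 sub_actM.

Definition sub_incl : ehom sub_eqmod M :=
  @mk_ehom _ _ sub_eqmod M val (fun _ _ _ => erefl) (fun _ _ => erefl).

Lemma sub_incl_inj x y : sub_incl x = sub_incl y -> x = y.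
Proof. exact: val_inj. Qed.

Lemma sub_inclP x : sub_incl x \in span_pred G.
Proof. exact: valP. Qed.

Lemma sub_incl_surj x : x \in span_pred G -> exists y, x = sub_incl y.
Proof. by move=> Sx; exists (Submod Sx). Qed.

Section Restrict.
Variables (L : eqmod A) (f : ehom L M).
Hypothesis fG : forall x, f x \in span_pred G.
Definition sub_lift_fun (x : L) : sub_eqmod := Submod (fG x).
Lemma sub_lift_linear : linear sub_lift_fun.
Proof. by move=> a x y; apply: val_inj; rewrite /= linearP. Qed.
Lemma sub_liftJ h x : sub_lift_fun (eact h x) = eact h (sub_lift_fun x).
Proof. by apply: val_inj; rewrite /= ehomJ. Qed.
Definition sub_lift : ehom L sub_eqmod := mk_ehom sub_lift_linear sub_liftJ.
End Restrict.

Definition quomod : Type := {ideal_quot (span G)}.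
HB.instance Definition _ := GRing.Zmodule.on quomod.

Definition quo_pi (x : M) : quomod := \pi_({ideal_quot (span G)})%qT x.

Lemma quo_pi_surj x : exists y, x = quo_pi y.
Proof. by exists (repr (x : {ideal_quot (span G)})); rewrite /quo_pi reprK. Qed.

Lemma quo_pi_eq x y : (quo_pi x == quo_pi y) = (x - y \in span_pred G).
Proof. by rewrite /quo_pi piE. Qed.

Lemma quo_piD x y : quo_pi (x + y) = quo_pi x + quo_pi y.
Proof. exact: raddfD. Qed.

Lemma quo_pi0 : quo_pi 0 = 0.
Proof. exact: raddf0. Qed.

Section QuoMap.
Variables (L : zmodType) (f : M -> L).
Hypotheses (fB : {morph f : x y / x - y}).
Hypothesis fG : forall x, x \in span_pred G -> f x = 0.
Definition quo_map (x : quomod) : L := f (repr (x : {ideal_quot (span G)})).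
Lemma quo_map_pi x : quo_map (quo_pi x) = f x.
Proof.
apply/eqP; rewrite -subr_eq0 -fB; apply/eqP/fG.
by rewrite -quo_pi_eq /quo_pi reprK.
Qed.
End QuoMap.

Definition quo_scale a := quo_map (fun x => quo_pi (a *: x)).

Lemma quo_scale_pi a x : quo_scale a (quo_pi x) = quo_pi (a *: x).
Proof.
apply: quo_map_pi => [y z|y Sy]; first by rewrite scalerBr; apply: raddfB.
by apply/eqP; rewrite -quo_pi0 quo_pi_eq subr0 span_scale.
Qed.

Lemma quo_scaleA b c x : quo_scale b (quo_scale c x) = quo_scale (b * c) x.
Proof. by have [u ->] := quo_pi_surj x; rewrite !quo_scale_pi scalerA. Qed.
Lemma quo_scale1 : left_id 1 quo_scale.
Proof. by move=> x; have [u ->] := quo_pi_surj x;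
  rewrite quo_scale_pi scale1r. Qed.
Lemma quo_scaleDr : right_distributive quo_scale +%R.
Proof.
move=> b x y; have [u ->] := quo_pi_surj x; have [v ->] := quo_pi_surj y.
by rewrite -quo_piD !quo_scale_pi -quo_piD scalerDr.
Qed.
Lemma quo_scaleDl x : {morph quo_scale^~ x : b c / b + c}.
Proof.
move=> b c; have [u ->] := quo_pi_surj x.
by rewrite !quo_scale_pi -quo_piD scalerDl.
Qed.
HB.instance Definition _ := GRing.Zmodule_isLmodule.Build A quomod
  quo_scaleA quo_scale1 quo_scaleDr quo_scaleDl.

Lemma quo_piZ a x : quo_pi (a *: x) = a *: quo_pi x.
Proof. by rewrite -quo_scale_pi. Qed.

Definition quo_act h := quo_map (fun x => quo_pi (eact h x)).

Lemma quo_act_pi h x : quo_act h (quo_pi x) = quo_pi (eact h x).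
Proof.
apply: quo_map_pi => [y z|y Sy]; first by rewrite eactB; apply: raddfB.
by apply/eqP; rewrite -quo_pi0 quo_pi_eq subr0 span_act.
Qed.

Lemma quo_actD h : {morph quo_act h : x y / x + y}.
Proof.
move=> x y; have [u ->] := quo_pi_surj x; have [v ->] := quo_pi_surj y.
by rewrite -quo_piD !quo_act_pi -quo_piD eactD.
Qed.
Lemma quo_actZ h a x : quo_act h (a *: x) = gact A h a *: quo_act h x.
Proof.
by have [u ->] := quo_pi_surj x; rewrite -quo_piZ !quo_act_pi -quo_piZ eactZ.
Qed.
Lemma quo_act1 x : quo_act 1%g x = x.
Proof. by have [u ->] := quo_pi_surj x; rewrite quo_act_pi eact1. Qed.
Lemma quo_actM g h x : quo_act (g * h)%g x = quo_act g (quo_act h x).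
Proof. by have [u ->] := quo_pi_surj x; rewrite !quo_act_pi eactM. Qed.

Definition quo_eqmod : eqmod A := EqMod quo_actD quo_actZ quo_act1 quo_actM.

Lemma quo_proj_linear : linear (quo_pi : M -> quo_eqmod).
Proof. by move=> a x y; rewrite quo_piD quo_piZ. Qed.
Lemma quo_projJ h x : quo_pi (eact h x) = eact h (quo_pi x : quo_eqmod).
Proof. by rewrite /= quo_act_pi. Qed.
Definition quo_proj : ehom M quo_eqmod := mk_ehom quo_proj_linear quo_projJ.

Lemma quo_proj_eq0 x : quo_proj x = 0 <-> x \in span_pred G.
Proof.
by split=> [/eqP|Sx]; [|apply/eqP]; rewrite /= -quo_pi0 quo_pi_eq subr0.
Qed.

Lemma quo_proj_surj (x : quo_eqmod) : exists y, x = quo_proj y.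
Proof. exact: quo_pi_surj. Qed.

Section QuoLift.
Variables (L : eqmod A) (f : ehom M L).
Hypothesis fG : forall x, x \in span_pred G -> f x = 0.
Definition quo_lift_fun : quo_eqmod -> L := quo_map f.
Lemma quo_lift_proj x : quo_lift_fun (quo_proj x) = f x.
Proof. by apply: quo_map_pi => // y z; rewrite ehomB. Qed.
Lemma quo_lift_linear : linear quo_lift_fun.
Proof.
move=> a x y; have [u ->] := quo_proj_surj x; have [v ->] := quo_proj_surj y.
by rewrite -linearP !quo_lift_proj linearP.
Qed.
Lemma quo_liftJ h x : quo_lift_fun (eact h x) = eact h (quo_lift_fun x).
Proof.
by have [u ->] := quo_proj_surj x; rewrite -ehomJ !quo_lift_proj ehomJ.
Qed.
Definition quo_lift : ehom quo_eqmod L := mk_ehom quo_lift_linear quo_liftJ.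
Lemma quo_liftE x : quo_lift (quo_proj x) = f x.
Proof. exact: quo_lift_proj. Qed.
End QuoLift.

End SubQuotient.

Section SubQuotientComplex.
Variables (H : finGroupType) (A : gring H) (X : cpx A) (G : forall i, X i ->
  Prop).
Hypothesis GJ : forall i h x, G x -> G (@eact _ _ (X i) h x).
Hypothesis Gd : forall i j (x : X i), G x -> G (cpx_d X i j x).

Lemma span_d i j x : x \in span_pred (@G i) ->
  cpx_d X i j x \in span_pred (@G j).
Proof.
have [S0 Slin] := span_submod_closed (@G j); move: x.
apply: (span_min (D := fun x => cpx_d X i j x \in span_pred (@G j))).
- by rewrite ehom0.
- by move=> a u v; rewrite ehomD ehomZ; apply: Slin.
by move=> x Gx; apply/span_gen/Gd.
Qed.

Definition sub_d i j : ehom (sub_eqmod (@GJ i)) (sub_eqmod (@GJ j)) :=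
  sub_lift (@GJ j) (f := ecomp (cpx_d X i j) (sub_incl (@GJ i)))
    (fun x => span_d j (sub_inclP x)).

Lemma sub_shape i j x : j != i + 1 -> sub_d i j x = 0.
Proof. by move=> nij; apply: val_inj; rewrite /= cpx_shape. Qed.
Lemma sub_dd i j l x : sub_d j l (sub_d i j x) = 0.
Proof. by apply: val_inj; rewrite /= cpx_dd. Qed.
Definition sub_cpx : cpx A := Cpx sub_shape sub_dd.
Definition sub_cmap : cmap sub_cpx X :=
  @CMap _ _ sub_cpx X (fun i => sub_incl (@GJ i)) (fun _ _ _ => erefl).

Lemma quo_d_subproof i j x : x \in span_pred (@G i) ->
  ecomp (quo_proj (@GJ j)) (cpx_d X i j) x = 0.
Proof. by move=> Sx; apply/quo_proj_eq0/span_d. Qed.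

Definition quo_d i j : ehom (quo_eqmod (@GJ i)) (quo_eqmod (@GJ j)) :=
  quo_lift (@GJ i) (@quo_d_subproof i j).

Lemma quo_dE i j x :
  quo_d i j (quo_proj (@GJ i) x) = quo_proj (@GJ j) (cpx_d X i j x).
Proof. exact: quo_liftE. Qed.

Lemma quo_shape i j x : j != i + 1 -> quo_d i j x = 0.
Proof.
by move=> nij; have [u ->] := quo_proj_surj x; rewrite quo_dE cpx_shape ?ehom0.
Qed.
Lemma quo_dd i j l x : quo_d j l (quo_d i j x) = 0.
Proof. by have [u ->] := quo_proj_surj x; rewrite !quo_dE cpx_dd ehom0. Qed.
Definition quo_cpx : cpx A := Cpx quo_shape quo_dd.
Definition quo_cmap : cmap X quo_cpx :=
  @CMap _ _ X quo_cpx (fun i => quo_proj (@GJ i)) (fun _ _ _ => esym (quo_dE _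
    _)).
End SubQuotientComplex.

(** * Restriction of scalars and its adjunction with base change *)

Section Restriction.
Variables (H : finGroupType) (A B : gring H) (f : ghom A B).

Section Module.
Variable M : eqmod B.
Definition resmod : Type := M.
HB.instance Definition _ := GRing.Zmodule.on resmod.

Definition res_scale (a : A) (x : resmod) : resmod := f a *: (x : M).
Lemma res_scaleA b c x : res_scale b (res_scale c x) = res_scale (b * c) x.
Proof. by rewrite /res_scale scalerA rmorphM. Qed.
Lemma res_scale1 : left_id 1 res_scale.
Proof. by move=> x; rewrite /res_scale rmorph1 scale1r. Qed.
Lemma res_scaleDr : right_distributive res_scale +%R.
Proof. by move=> a x y; rewrite /res_scale -scalerDr. Qed.
Lemma res_scaleDl x : {morph res_scale^~ x : b c / b + c}.
Proof. by move=> b c; rewrite /res_scale rmorphD scalerDl. Qed.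
HB.instance Definition _ := GRing.Zmodule_isLmodule.Build A resmod
  res_scaleA res_scale1 res_scaleDr res_scaleDl.

Definition res_act h (x : resmod) : resmod := @eact _ _ M h x.
Lemma res_actZ h a x : res_act h (a *: x) = gact A h a *: res_act h x.
Proof. by rewrite /res_act [eact _ _]eactZ -ghomJ. Qed.
Definition res_eqmod : eqmod A :=
  @EqMod _ _ resmod res_act (@eactD _ _ M) res_actZ (@eact1 _ _ M) (@eactM _ _
    M).

Lemma res_scaleE a (x : res_eqmod) : a *: x = (f a *: (x : M) : res_eqmod).
Proof. by []. Qed.
End Module.

Section Hom.
Variables (M N : eqmod B) (u : ehom M N).
Lemma res_hom_linear : linear (u : res_eqmod M -> res_eqmod N).
Proof. by move=> a x y; rewrite [LHS](linearP u). Qed.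
Definition res_hom : ehom (res_eqmod M) (res_eqmod N) :=
  @mk_ehom _ _ (res_eqmod M) (res_eqmod N) u res_hom_linear (ehomJ u).
End Hom.

Definition res_cpx (X : cpx B) : cpx A :=
  @Cpx _ _ (fun i => res_eqmod (X i)) (fun i j => res_hom (cpx_d X i j))
    (@cpx_shape _ _ X) (@cpx_dd _ _ X).

Section Adjoint.
Variables (M : eqmod A) (N : eqmod B).

Lemma bc_unit_linear : linear (@ext_in _ _ f M : M -> res_eqmod (bc_mod f M)).
Proof. by move=> a x y; rewrite ext_inD ext_inZ. Qed.
Definition bc_unit : ehom M (res_eqmod (bc_mod f M)) :=
  @mk_ehom _ _ M (res_eqmod (bc_mod f M)) (@ext_in _ _ f M) bc_unit_linear
    (fun h x => esym (bc_act_in f h x)).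

Variable u : ehom M (res_eqmod N).
Local Lemma adjD : {morph (u : M -> N) : x y / x + y}.
Proof. by move=> x y; exact: (ehomD u). Qed.
Local Lemma adjZ a x : (u (a *: x) : N) = idfun (f a) *: (u x : N).
Proof. exact: (ehomZ u). Qed.

Definition bc_adj_fun : bc_mod f M -> N := ext_lift idfun (u : M -> N).
Lemma bc_adj_linear : linear bc_adj_fun.
Proof.
by move=> a x y; rewrite /bc_adj_fun (ext_liftD adjD adjZ) (ext_liftZ adjD
  adjZ).
Qed.
Lemma bc_adj_fun_in b x : bc_adj_fun (b *: ext_in f x) = b *: (u x : N).
Proof. by rewrite /bc_adj_fun (ext_liftZ adjD adjZ) (ext_lift_in adjD adjZ).
  Qed.
Lemma bc_adj_fun0 : bc_adj_fun 0 = 0.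
Proof. by have := bc_adj_fun_in 0 0; rewrite !scale0r. Qed.
Lemma bc_adj_funD x y : bc_adj_fun (x + y) = bc_adj_fun x + bc_adj_fun y.
Proof. exact: (ext_liftD adjD adjZ). Qed.

Lemma bc_adjJ h x : bc_adj_fun (eact h x) = eact h (bc_adj_fun x).
Proof.
elim/ext_ind: x => [|x y IHx IHy|b x].
- by rewrite eact0 bc_adj_fun0 eact0.
- by rewrite eactD !bc_adj_funD IHx IHy eactD.
rewrite eactZ [eact _ _](bc_act_in f) !bc_adj_fun_in eactZ.
by congr (_ *: _); exact: (ehomJ u).
Qed.

Definition bc_adj : ehom (bc_mod f M) N := mk_ehom bc_adj_linear bc_adjJ.

Lemma bc_adjE b x : bc_adj (b *: ext_in f x) = b *: (u x : N).
Proof. exact: bc_adj_fun_in. Qed.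
End Adjoint.

Lemma bc_homE (M N : eqmod A) (u : ehom M N) b x :
  bc_hom f u (b *: ext_in f x) = b *: ext_in f (u x).
Proof. by rewrite /= bc_mapZ bc_map_in. Qed.

(** Only additivity is asked, so that the two sides of a homotopy formula can be compared on the
    elements b (x) x. *)
Lemma bc_ext (M : eqmod A) (L : zmodType) (u v : bc_mod f M -> L) :
    {morph u : x y / x + y} -> {morph v : x y / x + y} ->
  (forall b x, u (b *: ext_in f x) = v (b *: ext_in f x)) -> forall z, u z =
    v z.
Proof.
move=> uD vD uv; elim/ext_ind => [|x y IHx IHy|//].
  have u0 : u 0 = 0 by apply: (addIr (u 0)); rewrite -uD !add0r.
  by rewrite u0; apply: (addIr (v 0)); rewrite -vD !add0r.
by rewrite uD vD IHx IHy.
Qed.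

Lemma bc_cmapD (X Y : cpx A) (u : cmap X Y) i j x :
  bc_hom f (u j) (cpx_d (base_change f X) i j x) =
  cpx_d (base_change f Y) i j (bc_hom f (u i) x).
Proof.
move: x; apply: bc_ext => [x y|x y|b x]; rewrite ?ehomD //.
by rewrite !bc_homE cmapD.
Qed.
Definition bc_cmap (X Y : cpx A) (u : cmap X Y) :
    cmap (base_change f X) (base_change f Y) :=
  @CMap _ _ (base_change f X) (base_change f Y) (fun i => bc_hom f (u i))
    (bc_cmapD u).

Lemma bc_nullh (X Y : cpx A) (u : cmap X Y) :
  nullh (fun i x => u i x) -> nullh (fun i x => bc_cmap u i x).
Proof.
move=> [s sE]; exists (fun i j => bc_hom f (s i j)) => i; apply: bc_ext.
- exact: ehomD.
- by move=> x y; rewrite !ehomD addrACA.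
by move=> b x; rewrite !bc_homE sE ext_inD scalerDr.
Qed.

Lemma bc_cadjD (X : cpx A) (Y : cpx B) (u : cmap X (res_cpx Y)) i j x :
  bc_adj (u j) (cpx_d (base_change f X) i j x) = cpx_d Y i j (bc_adj (u i) x).
Proof.
move: x; apply: bc_ext => [x y|x y|b x]; rewrite ?ehomD //.
rewrite bc_homE !bc_adjE [RHS]ehomZ; congr (_ *: _).
exact: (cmapD u).
Qed.
Definition bc_cadj (X : cpx A) (Y : cpx B) (u : cmap X (res_cpx Y)) :
  cmap (base_change f X) Y :=
  @CMap _ _ (base_change f X) Y (fun i => bc_adj (u i)) (bc_cadjD u).

End Restriction.

(** * Complexes of representations in characteristic zero *)

Section Complement.
Variables (k : fieldType) (V : lmodType k) (S : V -> Prop).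
Hypothesis S0 : S 0.
Hypothesis Slin : forall a u v, S u -> S v -> S (a *: u + v).

Let lin_closed (K : V -> Prop) := forall a u v, K u -> K v -> K (a *: u + v).

Lemma complement_exists : exists K : V -> Prop,
  [/\ K 0, forall a u v, K u -> K v -> K (a *: u + v),
      forall x, K x -> S x -> x = 0 & forall v, exists s, S s /\ K (v - s)].
Proof.
pose P (K : set V) := lin_closed K /\ forall x, K x -> S x -> x = 0.
have [F FP Ftot|K [[Klin KS] Kmax]] := @Zorn_bigcup V P.
  split=> [a u v [X FX Xu] [Y FY Yv]|x [X FX Xx]]; last by apply: (FP X FX).2.
  have [XY|YX] := Ftot X Y FX FY.
    by exists Y => //; apply: (FP Y FY).1 => //; apply: XY.
  by exists X => //; apply: (FP X FX).1 => //; apply: YX.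
(* The empty set also satisfies [P], so membership of 0 needs maximality: a K without 0 would be
   empty, and {0} would be larger. *)
have K0 : K 0.
  apply: contrapT => nK0; apply: (Kmax [set 0]%classic); last first.
    by split=> [a u v /= -> ->|x /= -> //]; rewrite scaler0 addr0.
  have KE u : ~ K u.
    by move=> Ku; apply: nK0; have := Klin (-1) _ _ Ku Ku;
      rewrite scaleN1r addNr.
  by split=> [u /KE[]//|/(_ 0 erefl)/KE].
exists K; split=> // v; apply: contrapT => nv.
have [KV SV] : (forall a u, K u -> K (a *: u)) /\ (forall a u, S u ->
  S (a *: u)).
  by split=> a u ?; rewrite -[_ *: _]addr0; [apply: Klin|apply: Slin].
(* K' adjoins the line of v. A nonzero a with S x and K (x - a v) would give v the decomposition
   that it was assumed to lack, so K' still meets S only in 0, against maximality. *)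
pose K' : set V := fun x => exists a, K (x - a *: v).
apply: (Kmax K').
  split; first by move=> u Ku; exists 0; rewrite scale0r subr0.
  move=> K'K; apply: nv; exists 0; split=> //; rewrite subr0; apply: K'K.
  by exists 1; rewrite scale1r subrr.
split=> [a x y [b Kb] [c Kc]|x [a Ka] Sx].
  exists (a * b + c); have := Klin a _ _ Kb Kc; congr (K _).
  by rewrite scalerBr scalerA scalerDl opprD addrACA.
have [a0|a0] := eqVneq a 0.
  by apply: KS => //; move: Ka; rewrite a0 scale0r subr0.
case: nv; exists (a^-1 *: x); split; first exact: SV.
have := KV (- a^-1) _ Ka; congr (K _).
by rewrite scalerBr !scaleNr scalerA mulVf // scale1r opprK addrC.
Qed.

Lemma projection_exists : exists p : V -> V,
  [/\ linear p, forall x, S (p x) & forall x, S x -> p x = x].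
Proof.
have [K [K0 Klin KS VSK]] := complement_exists.
have [p pP] := boolp.choice VSK; exists p.
have SB u v : S u -> S v -> S (v - u).
  by move=> Su Sv; have := Slin (-1) Su Sv; rewrite scaleN1r addrC.
have KB u v : K u -> K v -> K (v - u).
  by move=> Ku Kv; have := Klin (-1) _ _ Ku Kv; rewrite scaleN1r addrC.
have uniq v s s' : S s -> K (v - s) -> S s' -> K (v - s') -> s = s'.
  move=> Ss Ks Ss' Ks'; apply/eqP; rewrite -subr_eq0; apply/eqP/KS;
    last exact: SB.
  by have := KB _ _ Ks Ks'; rewrite opprB addrC addrA subrK.
split=> [a x y|x|x Sx]; last 2 first.
- exact: (pP x).1.
- apply: (uniq x) => //; [exact: (pP x).1|exact: (pP x).2|by rewrite subrr].
have [[Sx Kx] [Sy Ky]] := (pP x, pP y).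
apply: (uniq (a *: x + y)); [exact: (pP _).1|exact: (pP _).2|exact: Slin|].
by have := Klin a _ _ Kx Ky; rewrite scalerBr opprD addrACA.
Qed.
End Complement.

(** Meant for maps known only by a property, such as a partial inverse of the differential:
    uniqueness makes the chosen function linear and equivariant. *)
Lemma ehom_of_rel (H : finGroupType) (A : gring H) (M N : eqmod A)
    (R : M -> N -> Prop) :
    (forall x, exists z, R x z) -> (forall x z z', R x z -> R x z' -> z = z') ->
    (forall a x y z w, R x z -> R y w -> R (a *: x + y) (a *: z + w)) ->
    (forall h x z, R x z -> R (eact h x) (eact h z)) ->
  exists u : ehom M N, forall x, R x (u x).
Proof.
move=> Rex Runiq Rlin RJ; have [u uP] := boolp.choice Rex.
have ul : linear u by move=> a x y; apply: (Runiq (a *: x + y)) => //;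
  apply: Rlin.
have uJ h x : u (eact h x) = eact h (u x).
  by apply: (Runiq (eact h x)) => //; apply: RJ.
by exists (mk_ehom ul uJ).
Qed.

Section Splitting.
Variables (k : fieldType) (char_k : [pchar k] =i pred0) (H : finGroupType).
Local Notation kH := (triv_gring H k).

Lemma card_neq0 : #|H|%:R != 0 :> k.
Proof.
by have /pcharf0P -> := char_k; rewrite -lt0n; apply/card_gt0P; exists 1%g;
  rewrite inE.
Qed.

Definition average (A : gring H) (M : eqmod A) (x : M) : M :=
  \sum_(h : H) eact h x.

Lemma eact_average (A : gring H) (M : eqmod A) h (x : M) :
  eact h (average x) = average x.
Proof.
rewrite /average eact_sum [RHS](reindex_inj (mulgI h)).
by apply: eq_bigr => g _; rewrite eactM.
Qed.

Lemma average_eact (A : gring H) (M : eqmod A) h (x : M) :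
  average (eact h x) = average x.
Proof.
rewrite /average [RHS](reindex_inj (mulIg h)).
by apply: eq_bigr => g _; rewrite eactM.
Qed.

Lemma average_fixed (A : gring H) (M : eqmod A) (x : M) :
  (forall h, eact h x = x) -> average x = x *+ #|H|.
Proof. by move=> xH; rewrite /average (eq_bigr (fun=> x)) // sumr_const. Qed.

Lemma averageD (A : gring H) (M : eqmod A) (x y : M) :
  average (x + y) = average x + average y.
Proof. by rewrite /average -big_split; apply: eq_bigr => h _;
  rewrite eactD. Qed.

Lemma ehom_average (A : gring H) (M N : eqmod A) (f : ehom M N) x :
  f (average x) = average (f x).
Proof. rewrite /average raddf_sum; apply: eq_bigr => h _; exact: ehomJ. Qed.

(** Maschke's theorem in arbitrary dimension: the linear projection comes from Zorn's lemma and is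
    averaged over H. *)
Lemma equivariant_projection (T : eqmod kH) (S : T -> Prop) :
    S 0 -> (forall a u v, S u -> S v -> S (a *: u + v)) ->
    (forall h u, S u -> S (eact h u)) ->
  exists p : ehom T T, (forall x, S (p x)) /\ (forall x, S x -> p x = x).
Proof.
move=> S0 Slin SJ; have [p [pl pS pid]] := projection_exists S0 Slin.
pose P x := #|H|%:R^-1 *: \sum_(h : H) eact h (p (eact h^-1%g x)).
have Pl : linear (P : T -> T).
  move=> a x y; rewrite /P scalerA mulrC -scalerA -scalerDr; congr (_ *: _).
  rewrite scaler_sumr -big_split; apply: eq_bigr => h _.
  by rewrite eactD eactZ /= pl eactD eactZ.
have PJ h x : P (eact h x) = eact h (P x).
  rewrite /P eactZ eact_sum; congr (_ *: _); rewrite (reindex_inj (mulgI h)).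
  by apply: eq_bigr => g _; rewrite invMg -eactM mulgKV eactM.
have SD u v : S u -> S v -> S (u + v).
  by move=> Su Sv; rewrite -[u]scale1r; apply: Slin.
exists (mk_ehom Pl PJ); split=> x.
  rewrite /= /P -[_ *: _]addr0; apply: Slin => //; apply: big_ind => // h _.
  exact/SJ/pS.
move=> Sx; rewrite /= /P (eq_bigr (fun=> x)) => [|h _].
  by rewrite sumr_const -scaler_nat scalerA mulVf ?scale1r ?card_neq0.
by rewrite pid; [rewrite -eactM mulgV eact1|apply: SJ].
Qed.

(** With projections [pZ] onto cocycles and [pB] onto coboundaries, e = pZ - pB pZ picks a
    complement of the coboundaries in the cocycles, a copy of the cohomology, and t inverts d from
    the coboundaries to ker pZ, a complement of the cocycles. *)
Lemma splitting (T : cpx kH) :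
  exists (t : forall i j, ehom (T i) (T j)) (e : forall i, ehom (T i) (T i)),
    [/\ forall p i q x, p + 1 = i -> i + 1 = q ->
          x = e i x + (cpx_d T p i (t i p x) + t q i (cpx_d T i q x)),
        forall i x, cocycle (e i x),
        forall i x, coboundary x -> e i x = 0 &
        forall i x, e i (e i x) = e i x].
Proof.
have projE (S : forall i, T i -> Prop) : (forall i, S i 0) ->
    (forall i a u v, S i u -> S i v -> S i (a *: u + v)) ->
    (forall i h u, S i u -> S i (eact h u)) ->
    exists p : forall i, ehom (T i) (T i), forall i,
    (forall x, S i (p i x)) /\ (forall x, S i x -> p i x = x).
  move=> S0 Slin SJ.
  pose p i := cid (equivariant_projection (S0 i) (Slin i) (SJ i)).
  by exists (fun i => projT1 (p i)) => i; apply: (projT2 (p i)).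
have [||| pZ pZP] := projE (fun i => @cocycle _ _ T i).
- by move=> i; rewrite /cocycle ehom0.
- by move=> i a u v; rewrite /cocycle ehomD ehomZ => -> ->;
  rewrite scaler0 addr0.
- by move=> i h u; apply: cocycle_act.
have [||| pB pBP] := projE (fun i => @coboundary _ _ T i).
- by move=> i; apply: coboundary0.
- by move=> i a u v [u' ->] [v' ->]; exists (a *: u' + v'); rewrite ehomD ehomZ.
- by move=> i h u; apply: coboundary_act.
have tE i j : exists u : ehom (T i) (T j), j + 1 = i ->
    forall x, pZ j (u x) = 0 /\ cpx_d T j i (u x) = pB i (pZ i x).
  have [ji|/eqP nji] := eqVneq (j + 1) i; last by exists (ezero _ _) => /nji.
  suff [u uP] : exists u : ehom (T i) (T j),
    forall x, pZ j (u x) = 0 /\ cpx_d T j i (u x) =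
      pB i (pZ i x) by exists u => _.
  apply: (ehom_of_rel (R := fun x z => pZ j z = 0 /\ cpx_d T j i z =
    pB i (pZ i x))).
  - move=> x; have [/(_ (pZ i x)) + _] := pBP i.
    move=> /(coboundaryP _ ji)[y yE]; exists (y - pZ j y).
    have [cZ idZ] := pZP j; rewrite !ehomB (idZ (pZ j y)) // subrr; split=> //.
    by rewrite yE (cocycleP _ (cZ y)) subr0.
  - move=> x z z' [Zz dz] [Zz' dz']; apply/eqP; rewrite -subr_eq0.
    have czz : cocycle (z - z') by rewrite /cocycle ji ehomB dz dz' subrr.
    by rewrite -((pZP j).2 _ czz) ehomB Zz Zz' subr0.
  - move=> a x y z w [Zz dz] [Zw dw]; rewrite !ehomD !ehomZ Zz Zw dz dw.
    by rewrite scaler0 addr0.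
  by move=> h x z [Zz dz]; rewrite !ehomJ Zz dz eact0.
exists (fun i j => projT1 (cid (tE i j))).
exists (fun i => eadd (pZ i) (eopp (ecomp (pB i) (pZ i)))).
have pZB i x : coboundary x -> pZ i x = x.
  by move=> /cocycle_coboundary; apply: (pZP i).2.
split.
- move=> p i q x pi iq /=.
  have /(_ pi x)[_ ->] := projT2 (cid (tE i p)).
  have /(_ iq (cpx_d T i q x))[Zt dt] := projT2 (cid (tE q i)).
  set z := projT1 (cid (tE q i)) _ in Zt dt *.
  (* Both z = t (d x) and x - pZ x lie in ker pZ and have differential d x, and d is injective on
     ker pZ. *)
  suff -> : z = x - pZ i x by rewrite subrKA addrC subrK.
  apply/eqP; rewrite -subr_eq0 opprB addrA; apply/eqP.
  have cZ := (pZP i).1 x; have db := coboundary_d q x.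
  have cz : cocycle (z + pZ i x - x).
    rewrite /cocycle iq ehomB ehomD dt (cocycleP _ cZ) addr0.
    by rewrite pZB // (pBP q).2 // subrr.
  by rewrite -((pZP i).2 _ cz) ehomB ehomD Zt add0r ((pZP i).2 _ cZ) subrr.
- move=> i x; apply: cocycleB; first exact: (pZP i).1.
  exact/cocycle_coboundary/(pBP i).1.
- by move=> i x xB; rewrite /= pZB // (pBP i).2 // subrr.
move=> i x /=; have [cZ _] := pZP i.
have bB : coboundary (pB i (pZ i x)) by apply: (pBP i).1.
have cy : cocycle (pZ i x - pB i (pZ i x)).
  by apply: cocycleB => //; apply: cocycle_coboundary.
by rewrite ((pZP i).2 _ cy) ehomB ((pBP i).2 _ bB) subrr subr0.
Qed.

(** Here the cocycle e x is a coboundary, so e x = e (e x) = 0 and t is a contraction. *)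
Lemma acyclic_contractible (T : cpx kH) :
  acyclic T -> nullh (fun i (x : T i) => x).
Proof.
move=> acT; have [t [e [te eZ eB ee]]] := splitting T.
apply/nullhP; exists t => p i q x pi iq; rewrite {1}(te p i q x pi iq).
by rewrite -ee eB ?add0r //; apply: acT.
Qed.

(** The coboundary h (e x) - e x is killed by e, and it is also fixed by e, which is equivariant and
    idempotent; hence it is zero. *)
Lemma harmonic_splitting (T : cpx kH) : cohomology_trivial T ->
  exists (t : forall i j, ehom (T i) (T j)) (e : forall i, ehom (T i) (T i)),
    (forall p i q x, p + 1 = i -> i + 1 = q ->
       x = e i x + (cpx_d T p i (t i p x) + t q i (cpx_d T i q x))) /\
    (forall i h x, eact h (e i x) = e i x).
Proof.
move=> Ttriv; have [t [e [te eZ eB ee]]] := splitting T; exists t, e;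
  split=> //.
move=> i h x; apply/eqP; rewrite -subr_eq0 -{1}(ee i x) -ehomJ -{2}(ee i x)
  -ehomB.
by rewrite eB //; apply: Ttriv.
Qed.
End Splitting.

Section BaseChangeFunctor.
Variables (H : finGroupType) (A B : gring H) (f : ghom A B).
Implicit Types M N L : eqmod A.

Lemma bc_hom_comp M N L (v : ehom N L) (u : ehom M N) x :
  bc_hom f v (bc_hom f u x) = bc_hom f (ecomp v u) x.
Proof.
move: x; apply: bc_ext => [x y|x y|b x]; rewrite ?ehomD //.
by rewrite !bc_homE.
Qed.

Lemma bc_hom_id M x : bc_hom f (eid M) x = x.
Proof. by move: x; apply: bc_ext => [x y||b x]; rewrite ?ehomD ?bc_homE. Qed.

Lemma bc_hom0 M N x : bc_hom f (ezero M N) x = 0.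
Proof.
move: x; apply: (bc_ext (v := fun=> 0)) => [x y|x y|b x];
  rewrite ?ehomD ?addr0 //.
by rewrite bc_homE ext_in0 scaler0.
Qed.

Lemma eq_bc_hom M N (u v : ehom M N) : (forall x, u x = v x) ->
  forall x, bc_hom f u x = bc_hom f v x.
Proof. by move=> uv; apply: bc_ext => [||b x]; rewrite ?bc_homE ?uv //;
  apply: ehomD. Qed.

(** Extension of scalars commutes with finite direct sums, so [phi] identifies the base change of
    the cone with the cone of the base change. *)
Lemma bc_cone_acyclic (X Y : cpx A) (u : cmap X Y) :
  acyclic (cone (bc_cmap f u)) -> acyclic (base_change f (cone u)).
Proof.
pose fst' i := bc_hom f (efst (X (i + 1)) (Y i)).
pose snd' i := bc_hom f (esnd (X (i + 1)) (Y i)).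
pose phi i : ehom (base_change f (cone u) i) (cone (bc_cmap f u) i) :=
  epairing (fst' i) (snd' i).
have phiD i j x : phi j (cpx_d (base_change f (cone u)) i j x) =
    cpx_d (cone (bc_cmap f u)) i j (phi i x).
  rewrite [RHS](cone_dE (bc_cmap f u)).
  congr pair.
    move: x; apply: bc_ext => [x y|x y|b x]; rewrite ?ehomD ?opprD //=.
    by rewrite !(bc_mapZ, bc_map_in) /= [ext_in f (- _)](ehomN (bc_unit f _))
      scalerN.
  have [<-|nij] := eqVneq (i + 1) j; last first.
    by rewrite ccast_neq // add0r !cpx_shape 1?eq_sym // ehom0.
  move: x; apply: bc_ext => [x y|x y|b x]; rewrite ?ehomD //.
    by rewrite [LHS]addrACA.
  rewrite /= !hcast_id !(bc_mapZ, bc_map_in) /= hcast_id ext_inD scalerDr.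
  reflexivity.
pose inl i := bc_hom f (epairing (eid (X (i + 1))) (ezero _ (Y i))).
pose inr i := bc_hom f (epairing (ezero _ (X (i + 1))) (eid (Y i))).
have phi_inj i x : phi i x = 0 -> x = 0.
  have E : x = inl i (fst' i x) + inr i (snd' i x).
    move: x; apply: bc_ext => [x y|x y|b [x y]]; first by [].
      by rewrite !ehomD [LHS]addrACA.
    rewrite !bc_homE -scalerDr -ext_inD; congr (_ *: ext_in f _).
    by congr pair; rewrite /= ?addr0 ?add0r.
  move=> phx; have fx : fst' i x = 0 := congr1 fst phx.
  have sx : snd' i x = 0 := congr1 snd phx.
  by rewrite E fx sx !ehom0 addr0.
have phi_surj i z : exists x, z = phi i x.
  case: z => a b; exists (inl i a + inr i b).
  have fst_inl c : fst' i (inl i c) = c.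
    by rewrite [LHS]bc_hom_comp -[RHS](bc_hom_id c); apply: eq_bc_hom.
  have fst_inr c : fst' i (inr i c) = 0.
    by rewrite [LHS]bc_hom_comp -[RHS](bc_hom0 (X (i + 1)) c); apply: eq_bc_hom.
  have snd_inl c : snd' i (inl i c) = 0.
    by rewrite [LHS]bc_hom_comp -[RHS](bc_hom0 (Y i) c); apply: eq_bc_hom.
  have snd_inr c : snd' i (inr i c) = c.
    by rewrite [LHS]bc_hom_comp -[RHS](bc_hom_id c); apply: eq_bc_hom.
  transitivity (fst' i (inl i a + inr i b), snd' i (inl i a + inr i b));
    last by [].
  by rewrite !ehomD fst_inl fst_inr snd_inl snd_inr addr0 add0r.
move=> ac i x cx; have /ac[z zE] : cocycle (phi i x : cone (bc_cmap f u) i).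
  by rewrite /cocycle -phiD (cocycleP _ cx) ehom0.
have [y yE] := phi_surj _ z.
exists y; apply/eqP; rewrite -subr_eq0; apply/eqP/phi_inj.
by rewrite ehomB phiD -yE -zE subrr.
Qed.
End BaseChangeFunctor.

Section CohomologyTrivial.
Variables (H : finGroupType) (A : gring H).

Lemma cohomology_trivial_quasi_iso (X Y : cpx A) (f : cmap X Y) :
  quasi_iso f -> cohomology_trivial X <-> cohomology_trivial Y.
Proof.
move=> qf; split=> [tX i y h cy|tY i x h cx].
  have [_ /(_ _ cy)[x [cx yx]]] := qf i.
  have [r yE] : exists r, y = r + f i x by exists (y - f i x); rewrite subrK.
  have {}yx : coboundary r by move: yx; rewrite yE addrK.
  have -> : eact h y - y = eact h r - r + f i (eact h x - x).
    by rewrite yE eactD ehomB ehomJ opprD addrACA.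
  apply: coboundaryD; last exact/coboundary_map/tX.
  by apply: coboundaryB => //; apply: coboundary_act.
have [inj _] := qf i; apply: inj.
  by apply: cocycleB => //; apply: cocycle_act.
by rewrite ehomB ehomJ; apply/tY/cocycle_map.
Qed.

Lemma cohomology_trivial_derived_iso (X Y : cpx A) :
  derived_iso X Y -> cohomology_trivial X <-> cohomology_trivial Y.
Proof.
move=> [Z [f [g [qf qg]]]].
by rewrite -(cohomology_trivial_quasi_iso qf) (cohomology_trivial_quasi_iso qg).
Qed.

Lemma cohomology_trivial_retract (X Y : cpx A) (u : cmap X Y) (v : cmap Y X) :
  nullh (fun i x => v i (u i x) - x) -> cohomology_trivial Y ->
  cohomology_trivial X.
Proof.
move=> vu tY i x h cx.
have cx' : cocycle (eact h x - x) by apply: cocycleB => //; apply: cocycle_act.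
have -> : eact h x - x = v i (u i (eact h x - x)) -
    (v i (u i (eact h x - x)) - (eact h x - x)) by rewrite subKr.
apply: coboundaryB; last exact: (nullh_coboundary vu cx').
by rewrite ehomB ehomJ; apply/coboundary_map/tY/cocycle_map.
Qed.
End CohomologyTrivial.

Lemma quasi_iso_homotopic (H : finGroupType) (A : gring H) (X Y : cpx A)
    (f g : cmap X Y) :
  nullh (fun i x => f i x - g i x) -> quasi_iso g -> quasi_iso f.
Proof.
move=> fg qg i; have [inj surj] := qg i.
have fgx (x : X i) : cocycle x -> coboundary (f i x - g i x).
  exact: (nullh_coboundary fg).
split=> [x cx fx|y cy].
  by apply: inj => //; rewrite -[g i x](subKr (f i x));
    apply: coboundaryB (fgx x cx).
have [x [cx yx]] := surj y cy; exists x; split=> //.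
have -> : y - f i x = (y - g i x) - (f i x - g i x) by rewrite opprB addrA
  subrK.
exact: coboundaryB (fgx x cx).
Qed.

Lemma bc_cadj_nullh (H : finGroupType) (A B : gring H) (f : ghom A B)
    (X : cpx A) (Y : cpx B) (u v : cmap X (res_cpx f Y)) :
  nullh (fun i x => u i x - v i x) ->
  nullh (fun i x => bc_cadj u i x - bc_cadj v i x).
Proof.
move=> [s sE]; exists (fun i j => bc_adj (s i j)) => i; apply: bc_ext.
- by move=> x y; rewrite !ehomD opprD [LHS]addrACA.
- by move=> x y; rewrite !ehomD [LHS]addrACA.
move=> b x; have uE w : bc_cadj u i (b *: ext_in f w) = b *: (u i w :
  Y i) by apply: bc_adjE.
have vE w : bc_cadj v i (b *: ext_in f w) = b *: (v i w :
  Y i) by apply: bc_adjE.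
rewrite uE vE -scalerBr; have -> := sE i x.
rewrite bc_homE !bc_adjE ehomZ; exact: scalerDr.
Qed.

(** * Descent along an augmentation with scalar averages *)

Section Augmented.
Variables (k : fieldType) (char_k : [pchar k] =i pred0) (H : finGroupType).
Local Notation kH := (triv_gring H k).
Variables (C : gring H) (s : ghom kH C) (eps : ghom C kH).
Hypothesis epsK : forall a, eps (s a) = a.
Hypothesis average_aug : forall c : C, \sum_(h : H) gact C h c =
  s (#|H|%:R * eps c).

Lemma eps_act h c : eps (gact C h c) = eps c.
Proof. exact: (ghomJ eps). Qed.

Lemma card_mul_eq0 (c : C) : #|H|%:R * c = 0 -> c = 0.
Proof.
move=> c0; rewrite -[c]mul1r -(rmorph1 s) -(mulVf (card_neq0 char_k H)).
by rewrite rmorphM rmorph_nat -mulrA c0 mulr0.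
Qed.

(* Benson's argument: for each t the product of the (t h) x_h - x_h over h
   vanishes, by the factor at h = t^-1.  On expanding and summing over t, the
   term of a nonempty set J of indices is a multiple of the average of an
   element of the augmentation ideal, so it vanishes; the empty set leaves
   the product of the - x_h, taken #|H| times. *)
Lemma prod_augmentation (x : H -> C) :
  (forall h, eps (x h) = 0) -> \prod_h x h = 0.
Proof.
move=> x0.
have E t : \prod_h (gact C (t * h)%g (x h) - x h) = 0.
  by rewrite (bigD1 t^-1%g) //= mulgV gact1 subrr mul0r.
have : \sum_(t : H) \prod_h (gact C (t * h)%g (x h) - x h) = 0 by apply: big1.
have expand t : \prod_h (gact C (t * h)%g (x h) - x h) =
    \sum_(J in {set H}) \prod_h (if h \in J then gact C (t * h)%g (x h) else -
      x h).
  exact: bigA_distr.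
rewrite (eq_bigr _ (fun t _ => expand t)) exchange_big (bigD1 finset.set0) //=
  [X in _ + X]big1 => [|J J0].
  rewrite addr0 (eq_bigr (fun=> \prod_h - x h)) => [|t _]; last first.
    by apply: eq_bigr => h _; rewrite inE.
  rewrite sumr_const -mulr_natl => /card_mul_eq0.
  by rewrite prodrN => /eqP; rewrite -signr_odd mulr_sign; case: ifP => _;
    rewrite ?oppr_eq0 => /eqP.
have [h0 h0J] := finset.set0Pn _ J0.
transitivity ((\sum_t gact C t (\prod_(h in J) gact C h (x h))) *
    \prod_(h | h \notin J) - x h).
  rewrite mulr_suml; apply: eq_bigr => t _; rewrite (bigID (mem J)) /=
    rmorph_prod.
  congr (_ * _); apply: eq_bigr => h; last by move/negPf->.
  by move=> ->; rewrite gactM.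
rewrite average_aug rmorph_prod (bigD1 h0) //= eps_act x0 mul0r mulr0.
by rewrite rmorph0 mul0r.
Qed.

Lemma augmentation_nilpotent (cs : seq C) : size cs = #|H| ->
  (forall c, c \in cs -> eps c = 0) -> \prod_(c <- cs) c = 0.
Proof.
move=> scs cs0; rewrite (big_nth 0) scs big_mkord (reindex_onto enum_rank
  enum_val).
  rewrite (eq_bigl xpredT) => [|h]; last by rewrite enum_rankK eqxx.
  apply: (prod_augmentation (x := fun h => cs`_(enum_rank h))) => h.
  by apply/cs0/mem_nth; rewrite scs.
by move=> i _; apply: enum_valK.
Qed.

Definition killed (M : eqmod C) := forall c (x : M), eps c = 0 -> c *: x = 0.

Lemma killed_scale (M : eqmod C) c (x : M) : killed M -> s (eps c) *: x =
  c *: x.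
Proof.
move=> Mk; apply/eqP; rewrite -subr_eq0 -scalerBl Mk //.
by rewrite rmorphB /= epsK subrr.
Qed.

Section KilledTarget.
Variables (P Y : cpx C).
Hypothesis Yk : forall i, killed (Y i).

(** On a module killed by the augmentation ideal, c acts as [s (eps c)]. Such a module is thus a
    representation of H over k, pulled back along [eps]. *)
Lemma kill_in_linear i : linear (fun x : Y i => x :
  res_eqmod eps (res_eqmod s (Y i))).
Proof.
by move=> a x y; rewrite !res_scaleE; congr (_ + _); rewrite killed_scale.
Qed.
Definition kill_in i : ehom (Y i) (res_eqmod eps (res_eqmod s (Y i))) :=
  mk_ehom (@kill_in_linear i) (fun _ _ => erefl).
Lemma kill_out_linear i : linear (fun x : res_eqmod eps (res_eqmod s (Y i)) =>
  x : Y i).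
Proof.
by move=> a x y; rewrite !res_scaleE; congr (_ + _); rewrite killed_scale.
Qed.
Definition kill_out i : ehom (res_eqmod eps (res_eqmod s (Y i))) (Y i) :=
  mk_ehom (@kill_out_linear i) (fun _ _ => erefl).

(** By adjunction f factors through the base change of P along [eps], as a map g. Applying g to the
    decomposition of the identity removes the e-term, and g t, composed with P -> k (x) P, is a
    homotopy. *)
Lemma killed_target_nullh (f : cmap P Y)
    (t : forall i j, ehom (base_change eps P i) (base_change eps P j))
    (e : forall i, ehom (base_change eps P i) (base_change eps P i)) :
    (forall p i q x, p + 1 = i -> i + 1 = q ->
       x = e i x + (cpx_d _ p i (t i p x) + t q i (cpx_d _ i q x))) ->
    (forall i (g : ehom (base_change eps P i) (res_eqmod s (Y i))) x, g (e i x)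
      = 0) ->
  nullh (fun i x => f i x).
Proof.
move=> te ge.
have fD i j x : ecomp (kill_in j) (f j) (cpx_d P i j x) =
    cpx_d (res_cpx eps (res_cpx s Y)) i j (ecomp (kill_in i) (f i) x).
  by rewrite /= cmapD.
pose f' : cmap P (res_cpx eps (res_cpx s Y)) :=
  @CMap _ _ P (res_cpx eps (res_cpx s Y)) (fun i => ecomp (kill_in i) (f i)) fD.
pose g := bc_cadj f'.
have gE i x : (g i (ext_in eps x) : Y i) = f i x.
  by have := bc_adjE (f' i) 1 x; rewrite !scale1r.
pose h i j : ehom (P i) (Y j) := ecomp (kill_out j)
  (ecomp (res_hom eps (ecomp (g j) (t i j))) (bc_unit eps (P i))).
apply/nullhP; exists h => p i q x pi iq.
have hE r l y : h r l y = g l (t r l (ext_in eps y)) by [].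
have := congr1 (g i) (te p i q (ext_in eps x) pi iq).
rewrite gE ehomD ge add0r ehomD => ->; rewrite !hE; congr (_ + _).
  exact: (cmapD g).
by rewrite [cpx_d (base_change _ _) _ _ _]bc_map_in.
Qed.
End KilledTarget.

(** * Filtering the target by powers of the augmentation ideal *)

Section Devissage.
Variable P : cpx C.
Hypothesis KP : Kprojective P.
Variable Pr : eqmod C -> Prop.
Hypothesis Pr_sub : forall (M : eqmod C) (G : M -> Prop)
  (GJ : forall h x, G x -> G (eact h x)), Pr M -> Pr (sub_eqmod GJ).
Hypothesis Pr_quo : forall (M : eqmod C) (G : M -> Prop)
  (GJ : forall h x, G x -> G (eact h x)), Pr M -> Pr (quo_eqmod GJ).
Hypothesis base : forall Y : cpx C, (forall i, Pr (Y i)) ->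
  (forall i, killed (Y i)) ->
  forall f : cmap P Y, nullh (fun i x => f i x).

(** The composite P -> Y -> Y/mY is null-homotopic by [base], so by [exact_mid] f factors up to
    homotopy through mY, which is killed by products of one factor fewer. [Pr] passes to
    subquotients and so survives the induction. *)
Lemma devissage n (Y : cpx C) : (forall i, Pr (Y i)) ->
    (forall i (cs : seq C) (x : Y i), size cs = n ->
       (forall c, c \in cs -> eps c = 0) -> (\prod_(c <- cs) c) *: x = 0) ->
  forall f : cmap P Y, nullh (fun i x => f i x).
Proof.
elim: n Y => [|n IHn] Y PrY Yk f.
  apply: eq_nullh (nullh0 P Y) => i x.
  by rewrite -[f i x]scale1r; have := Yk i [::] (f i x) erefl;
    rewrite big_nil => ->.
pose G i (x : Y i) := exists c (y : Y i), eps c = 0 /\ x = c *: y.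
have GJ i h x : G i x -> G i (eact h x).
  by move=> [c [y [c0 ->]]]; exists (gact C h c), (eact h y);
    rewrite eactZ eps_act.
have Gd i j x : G i x -> G j (cpx_d Y i j x).
  by move=> [c [y [c0 ->]]]; exists c, (cpx_d Y i j y); rewrite ehomZ.
pose u := sub_cmap GJ Gd; pose v := quo_cmap GJ Gd.
have vk i : killed (quo_cpx GJ Gd i).
  move=> c x c0; have [y ->] := quo_proj_surj x.
  rewrite -ehomZ; apply/quo_proj_eq0/span_gen; by exists c, y.
have uk i (cs : seq C) (x : sub_cpx GJ Gd i) : size cs = n ->
    (forall c, c \in cs -> eps c = 0) -> (\prod_(c <- cs) c) *: x = 0.
  move=> scs cs0; apply: sub_incl_inj; rewrite ehomZ ehom0.
  move: (sub_inclP x); move: (sub_incl _ x); apply: (span_min (D :=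
    fun y => (\prod_(c <- cs) c) *: y = 0)).
  - by rewrite scaler0.
  - by move=> a y z y0 z0; rewrite scalerDr scalerA mulrC -scalerA y0 z0
    scaler0 addr0.
  move=> _ [c [y [c0 ->]]]; rewrite scalerA mulrC.
  have := Yk i (c :: cs) y; rewrite big_cons; apply=> /=; first by rewrite scs.
  by move=> d; rewrite inE => /predU1P[->|/cs0].
have vf := @base (quo_cpx GJ Gd) (fun i => Pr_quo (GJ i) (PrY i)) vk (ccomp v
  f).
have [||||l lE] := @exact_mid _ _ _ _ _ u v _ _ _ _ P f KP vf.
- by move=> i x ux0; apply: sub_incl_inj; rewrite [LHS]ux0 ehom0.
- by move=> i z; apply: quo_proj_surj.
- by move=> i x; apply/quo_proj_eq0/sub_inclP.
- by move=> i y /quo_proj_eq0 /sub_incl_surj; apply.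
have ln := @IHn (sub_cpx GJ Gd) (fun i => Pr_sub (GJ i) (PrY i)) uk l.
have := nullhB (nullh_compl u ln) lE.
by apply: eq_nullh => i x; rewrite subKr.
Qed.

Lemma devissage_nilp (Y : cpx C) : (forall i, Pr (Y i)) ->
  forall f : cmap P Y, nullh (fun i x => f i x).
Proof.
move=> PrY; apply: (devissage (n := #|H|)) => // i cs x scs cs0.
by rewrite augmentation_nilpotent ?scale0r.
Qed.
End Devissage.

(* The terms of a K-projective complex need not be flat, so the usual filtration
   of C (x) D by powers of the augmentation ideal is not available; the target
   of a map out of D is filtered instead. *)
Lemma Kprojective_nakayama (D : cpx C) :
  Kprojective D -> acyclic (base_change eps D) -> acyclic D.
Proof.
move=> KD acD; apply: nullh_id_acyclic.
apply: (devissage_nilp KD (Pr := fun=> True) _ _ _ _ (cmap_id D)) => // Y _ Yk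
  f.
have /nullhP[t tE] := acyclic_contractible char_k acD.
apply: (killed_target_nullh Yk f (t := t) (e := fun i => ezero _ _)).
  by move=> p i q x pi iq; rewrite /= add0r; apply: tE.
by move=> i g x; rewrite /= ehom0.
Qed.

Definition no_invariants (M : eqmod C) := forall x : M, (forall h, eact h x =
  x) -> x = 0.

Lemma natmul_card_eq0 (M : eqmod C) (x : M) : x *+ #|H| = 0 -> x = 0.
Proof.
move=> x0; rewrite -[x]scale1r -(rmorph1 s) -(mulVf (card_neq0 char_k H)).
by rewrite rmorphM -scalerA rmorph_nat scaler_nat x0 scaler0.
Qed.

(** After the devissage the target is killed by m, and the map factors through the base change of P.
    The image of e there consists of invariants, which an equivariant map must send to zero. *)
Lemma no_invariants_nullh (P Y : cpx C) : Kprojective P ->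
    cohomology_trivial (base_change eps P) -> (forall i, no_invariants (Y i)) ->
  forall f : cmap P Y, nullh (fun i x => f i x).
Proof.
move=> KP tP; apply: (devissage_nilp KP) => {Y}.
- move=> M G GJ M0 x xH; apply: sub_incl_inj; rewrite ehom0; apply: M0 => h.
  by rewrite -ehomJ xH.
(* In a quotient, #|H| x is the image of the average of a preimage y, and that average is an
   invariant of M. *)
- move=> M G GJ M0 x xH; have [y xE] := quo_proj_surj x.
  apply: natmul_card_eq0; rewrite -(average_fixed xH) xE -ehom_average.
  by rewrite (M0 (average y)) ?ehom0 // => h; apply: eact_average.
move=> Y Y0 Yk f; have [t [e [te eH]]] := harmonic_splitting char_k tP.
apply: (killed_target_nullh Yk f te) => i g x; apply: Y0 => h.
by rewrite -[eact h _](ehomJ g) eH.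
Qed.

(** The contraction t of Y lives over k and need not be C-linear. It is composed with the
    restriction W -> Y of f, and the result is extended C-linearly to C (x) W. *)
Lemma Kprojective_base_change (W : cpx kH) : Kprojective (base_change s W).
Proof.
move=> Y f acY.
have /nullhP[t tE] : nullh (fun i (x : res_cpx s Y i) => x).
  by apply: acyclic_contractible.
pose f0 i : ehom (W i) (res_eqmod s (Y i)) :=
  ecomp (res_hom s (f i)) (bc_unit s (W i)).
pose h i j : ehom (base_change s W i) (Y j) := bc_adj (ecomp (t i j) (f0 i)).
have hE i j b x : h i j (b *: ext_in s x) = b *: (t i j (f0 i x) : Y j).
  exact: bc_adjE.
apply/nullhP; exists h => p i q + pi iq; apply: bc_ext.
- exact: ehomD.
- by move=> x y; rewrite !ehomD [LHS]addrACA.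
move=> b x; rewrite ehomZ; have := tE p i q (f0 i x) pi iq => tfE.
rewrite [f i _]tfE scalerDr hE -ehomZ; congr (_ + _).
rewrite [cpx_d (base_change _ _) _ _ _]bc_homE hE.
congr (_ *: _); congr (t q i _); rewrite /f0 /=;
  rewrite -[ext_in s (cpx_d _ _ _ _)](bc_map_in s).
by symmetry; apply: (cmapD f).
Qed.

(** * The complexes C (x) W with W trivial *)

Section Trivial.
Variables (W : cpx kH) (trivW : trivial_action W).
Local Notation Q := (base_change s W).

Lemma counit_linear i :
  linear (fun x : W i => x : res_eqmod s (res_eqmod eps (W i))).
Proof. by move=> a x y; rewrite !res_scaleE epsK. Qed.
Definition counit_hom i : ehom (W i) (res_eqmod s (res_eqmod eps (W i))) :=
  mk_ehom (@counit_linear i) (fun _ _ => erefl).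
Definition counit_cmap : cmap W (res_cpx s (res_cpx eps W)) :=
  @CMap _ _ W (res_cpx s (res_cpx eps W)) counit_hom (fun _ _ _ => erefl).
Definition counit : cmap Q (res_cpx eps W) := bc_cadj counit_cmap.

Lemma counitE i c w : counit i (c *: ext_in s w) = eps c *: (w : W i).
Proof. exact: bc_adjE. Qed.

Lemma counit_in i w : counit i (ext_in s w) = (w : W i).
Proof. by rewrite -[ext_in s w]scale1r counitE rmorph1 scale1r. Qed.

Lemma average_bc i (x : Q i) : exists w : W i, average x = ext_in s w.
Proof.
elim/ext_ind: x => [|x y [w wE] [v vE]|c w].
- by exists 0; rewrite ext_in0 average_fixed ?mul0rn // => h; rewrite eact0.
- by exists (w + v); rewrite averageD wE vE ext_inD.
exists ((#|H|%:R * eps c) *: w); rewrite ext_inZ -average_aug scaler_suml.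
apply: eq_bigr => h _; rewrite eactZ; congr (_ *: _).
by rewrite [LHS](bc_act_in s) trivW.
Qed.

Lemma counit_ker_no_invariants i (x : Q i) :
  counit i x = 0 -> (forall h, eact h x = x) -> x = 0.
Proof.
move=> x0 xH; apply: natmul_card_eq0; rewrite -(average_fixed xH).
(* The average of x is 1 (x) w, and w is recovered by applying [counit], which gives the average of
   [counit i x], that is, zero. *)
have [w wE] := average_bc x; rewrite wE -(counit_in w) -wE ehom_average x0.
by rewrite average_fixed ?mul0rn ?ext_in0 // => h; apply: eact0.
Qed.

Definition fibre : cmap (base_change eps Q) W := bc_cadj counit.

Lemma fibreE i b z : fibre i (b *: ext_in eps z) = b *: (counit i z : W i).
Proof. exact: bc_adjE. Qed.

(** In k (x) (C (x) W) the scalar c crosses the outer tensor as eps c. This makes w |-> 1 (x) (1 (x)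
    w) inverse to [fibre]. *)
Lemma ext_in_counit i (z : Q i) :
  ext_in eps z = ext_in eps (ext_in s (counit i z : W i)).
Proof.
move: z; apply: bc_ext; first exact: ext_inD.
  by move=> x y; rewrite ehomD [ext_in s _]ext_inD [LHS]ext_inD.
by move=> c w; rewrite counitE [ext_in s (_ *: _)]ext_inZ [LHS]ext_inZ
  [RHS]ext_inZ epsK.
Qed.

Lemma fibreK i z : z = ext_in eps (ext_in s (fibre i z)).
Proof.
move: z; apply: bc_ext => [//||b z].
  by move=> x y; rewrite ehomD [ext_in s _]ext_inD [LHS]ext_inD.
rewrite fibreE [ext_in s _]ext_inZ [RHS]ext_inZ epsK.
by rewrite [in LHS]ext_in_counit.
Qed.

Lemma fibre_in i (w : W i) : fibre i (ext_in eps (ext_in s w)) = w.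
Proof. by rewrite -[ext_in eps _]scale1r fibreE scale1r counit_in. Qed.

Lemma fibre_trivial : cohomology_trivial (base_change eps Q).
Proof.
move=> i x h _; suff -> : eact h x = x by rewrite subrr; apply: coboundary0.
by rewrite [LHS]fibreK [RHS]fibreK ehomJ trivW.
Qed.

(** Nakayama is applied to the cone of l, which is K-projective. Its base change is the cone of the
    base change of l, acyclic because [fibre] is an isomorphism. *)
Lemma quasi_iso_fibre (P : cpx C) (l : cmap P Q) : Kprojective P ->
  quasi_iso (ccomp fibre (bc_cmap eps l)) -> quasi_iso l.
Proof.
move=> KP qfl; apply: cone_acyclic_quasi_iso.
apply: Kprojective_nakayama; first exact: Kprojective_cone KP
  (@Kprojective_base_change W).
apply/bc_cone_acyclic/cone_acyclic => i; have [inj surj] := qfl i.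
have fibre_cob (y : base_change eps Q i) : coboundary (fibre i y) ->
  coboundary y.
  move=> [w fy]; exists (ext_in eps (ext_in s w)).
  by rewrite [LHS]fibreK [RHS]fibreK fy cmapD fibre_in.
split=> [x cx lx|y cy].
  by apply: inj => //; apply/(coboundary_map fibre).
have [x [cx yx]] := surj _ (cocycle_map fibre cy); exists x; split=> //.
by apply: fibre_cob; rewrite ehomB.
Qed.

Let ker i (x : Q i) := counit i x = 0.
Let kerJ i h x : @ker i x -> @ker i (eact h x).
Proof. by rewrite /ker => x0; rewrite (ehomJ (counit i)) x0 eact0. Qed.
Let kerD i j x : @ker i x -> @ker j (cpx_d Q i j x).
Proof. by rewrite /ker => x0; rewrite (cmapD counit) x0 ehom0. Qed.
Definition counit_ker : cpx C := sub_cpx kerJ kerD.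

Lemma span_counit_ker i x : x \in span_pred (@ker i) -> counit i x = 0.
Proof.
move: x; apply: (span_min (D := fun x => counit i x = 0)).
- exact: (ehom0 (counit i)).
- move=> a x y x0 y0.
  have -> : counit i (a *: x + y) = a *: counit i x + counit i y.
    exact: (linearP (counit i)).
  by rewrite x0 y0 scaler0 addr0.
by move=> x x0; exact: x0.
Qed.

Lemma no_invariants_counit_ker i : no_invariants (counit_ker i).
Proof.
move=> x xH; apply: sub_incl_inj; rewrite ehom0.
apply: counit_ker_no_invariants.
  exact: span_counit_ker (sub_inclP x).
by move=> h; rewrite -[LHS]ehomJ; congr (sub_incl _ _); apply: xH.
Qed.

Lemma counit_lift (P : cpx C) (f : cmap P (res_cpx eps W)) :
    Kprojective P -> cohomology_trivial (base_change eps P) ->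
  exists l : cmap P Q, nullh (fun i x => counit i (l i x) - f i x).
Proof.
move=> KP tT; apply: (exact_lift (u := sub_cmap kerJ kerD)) => //.
- by move=> i x x0; apply: sub_incl_inj; rewrite [LHS]x0 ehom0.
- by move=> i w; exists (ext_in s (w : W i)); rewrite counit_in.
- by move=> i x; apply: span_counit_ker (sub_inclP x).
- by move=> i x x0; apply: sub_incl_surj; apply: span_gen.
by apply: no_invariants_nullh => // i; apply: no_invariants_counit_ker.
Qed.

(** The map to lift is the transpose of r. Homotopic maps have homotopic transposes, so the lift
    induces r on derived fibres up to homotopy. *)
Lemma resolution_by_trivial (P : cpx C) (r : cmap (base_change eps P) W) :
    Kprojective P -> cohomology_trivial (base_change eps P) -> quasi_iso r ->
  exists l : cmap P Q, quasi_iso l.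
Proof.
move=> KP tT qr.
have fD i j x : ecomp (res_hom eps (r j)) (bc_unit eps (P j)) (cpx_d P i j x) =
    cpx_d (res_cpx eps W) i j (ecomp (res_hom eps (r i)) (bc_unit eps (P i)) x).
  by rewrite /= -(bc_map_in eps); exact: (cmapD r).
pose f : cmap P (res_cpx eps W) := @CMap _ _ P (res_cpx eps W)
  (fun i => ecomp (res_hom eps (r i)) (bc_unit eps (P i))) fD.
have [l lE] := counit_lift f KP tT; exists l; apply: quasi_iso_fibre => //.
apply: quasi_iso_homotopic qr.
apply: eq_nullh (bc_cadj_nullh (u := ccomp counit l) (v := f) lE) => i.
apply: bc_ext.
- by move=> x y; rewrite !ehomD opprD [LHS]addrACA.
- by move=> x y; rewrite !ehomD opprD [LHS]addrACA.
move=> b x; congr (_ - _).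
  transitivity (fibre i (b *: ext_in eps (l i x))).
    by rewrite fibreE; exact: bc_adjE.
  by congr (fibre i _); rewrite [RHS]bc_homE.
transitivity (b *: r i (ext_in eps x)); first exact: bc_adjE.
exact: esym (ehomZ (r i) b _).
Qed.

Lemma descent_fibre_trivial (P F : cpx C) (p : cmap P F) :
    Kprojective P -> quasi_iso p -> derived_iso F Q ->
  cohomology_trivial (base_change eps P).
Proof.
move=> KP qp [Z [f [g [qf qg]]]].
have KQ : Kprojective Q := @Kprojective_base_change W.
have [l fl] := Kprojective_lift p KP qf.
have [u gu] := Kprojective_lift (cmap_id Q) KQ qg.
have [a pa] := Kprojective_lift (ccomp f u) KQ qp.
pose b := ccomp g l.
(* It suffices to compare after the quasi-isomorphism g: there g u b is homotopic to b = g l. *)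
have ub : nullh (fun i x => u i (b i x) - l i x).
  apply: (Kprojective_lift_null (l := csub (ccomp u b) l) KP qg).
  by apply: eq_nullh (nullh_compr b gu) => i x; rewrite [in RHS]/= ehomB.
(* Compared after the quasi-isomorphism p, through the homotopies p a b ~ f u b ~ f l ~ p. *)
have ab : nullh (fun i x => csub (ccomp a b) (cmap_id P) i x).
  apply: (Kprojective_lift_null KP qp).
  have := nullhD (nullhD (nullh_compr b pa) (nullh_compl f ub)) fl.
  apply: eq_nullh => i x; rewrite [in RHS]/= !ehomB /=.
  by rewrite !subrKA.
apply: (cohomology_trivial_retract (u := bc_cmap eps b) (v := bc_cmap eps a));
  last first.
  exact: fibre_trivial.
apply: eq_nullh (bc_nullh eps ab) => i; apply: bc_ext.
- exact: ehomD.
- by move=> x y; rewrite !ehomD opprD [LHS]addrACA.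
move=> c x; rewrite !bc_homE -scalerBr; congr (_ *: _).
exact: (ehomB (bc_unit eps (P i))).
Qed.

End Trivial.

(** * Averaging onto the invariants of the derived fibre *)

Section Backward.
Variables (P : cpx C).
Local Notation T := (base_change eps P).
Let inv i (x : T i) := forall h, eact h x = x.
Let invJ i h x : @inv i x -> @inv i (eact h x).
Proof. by move=> xH; rewrite xH. Qed.
Let invD i j x : @inv i x -> @inv j (cpx_d T i j x).
Proof. by move=> xH h; rewrite -ehomJ xH. Qed.
Definition invariants : cpx kH := sub_cpx invJ invD.

Lemma span_inv i x : x \in span_pred (@inv i) -> inv x.
Proof.
move: x; apply: span_min => //; first by move=> h; apply: eact0.
by move=> a u v uH vH h; rewrite eactD eactZ uH vH.
Qed.

Lemma invariants_trivial : trivial_action invariants.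
Proof.
move=> i h x; apply: sub_incl_inj; rewrite ehomJ.
exact: (span_inv (sub_inclP x)).
Qed.

Lemma reynolds_linear i : linear (fun x : T i => #|H|%:R^-1 *: average x : T i).
Proof.
move=> a x y; rewrite scalerA mulrC -scalerA -scalerDr; congr (_ *: _).
by rewrite averageD; congr (_ + _); rewrite /average scaler_sumr;
   apply: eq_bigr => h _; rewrite eactZ.
Qed.
Lemma reynoldsJ i h (x : T i) :
  #|H|%:R^-1 *: average (eact h x) = @eact _ _ (T i) h (#|H|%:R^-1 *: average
    x).
Proof. by rewrite average_eact eactZ eact_average. Qed.
Definition reynolds i : ehom (T i) (T i) := mk_ehom (@reynolds_linear i)
  (@reynoldsJ i).

Lemma reynolds_inv i x : reynolds i x \in span_pred (@inv i).
Proof. by apply/span_gen => h; rewrite -ehomJ /= average_eact. Qed.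

Lemma reynolds_id i x : inv x -> reynolds i x = x.
Proof.
move=> xH; rewrite /= average_fixed // -scaler_nat scalerA mulVf ?scale1r //.
exact: card_neq0.
Qed.

(** The difference is the mean over H of the x - h x, each of them a coboundary. *)
Lemma reynolds_coboundary i (x : T i) : cohomology_trivial T -> cocycle x ->
  coboundary (x - reynolds i x).
Proof.
move=> tT cx; have -> : x - reynolds i x = #|H|%:R^-1 *: \sum_(h :
  H) (x - eact h x).
  rewrite sumrB scalerBr sumr_const -scaler_nat scalerA mulVf ?scale1r //.
  exact: card_neq0.
have cobZ a (y : T i) : coboundary y -> coboundary (a *: y).
  by move=> [z ->]; exists (a *: z); rewrite ehomZ.
apply: cobZ; apply: big_ind => [||h _]; [exact: coboundary0|exact:
  coboundaryD|].
by rewrite -opprB; apply/coboundaryN/tT.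
Qed.

Definition to_invariants i : ehom (T i) (invariants i) :=
  sub_lift (@invJ i) (@reynolds_inv i).
Lemma to_invariantsD i j x : to_invariants j (cpx_d T i j x) =
  cpx_d invariants i j (to_invariants i x).
Proof.
apply: sub_incl_inj; rewrite [LHS]/(reynolds j _) [RHS]/(cpx_d T i j (reynolds
  i x)).
by rewrite /= -[RHS]/(cpx_d T i j _) ehomZ ehom_average.
Qed.
Definition to_invariants_cmap : cmap T invariants :=
  @CMap _ _ T invariants to_invariants to_invariantsD.

Lemma to_invariants_quasi_iso : cohomology_trivial T ->
  quasi_iso to_invariants_cmap.
Proof.
move=> tT.
have toK i (x : T i) : sub_cmap invJ invD i (to_invariants_cmap i x) =
  reynolds i x by [].
move=> i; split=> [x cx rx|w cw].
  have {}rx : coboundary (reynolds i x) by rewrite -toK; apply: coboundary_map.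
  by rewrite -[x](subrK (reynolds i x)); apply: coboundaryD rx;
    apply: reynolds_coboundary.
exists (sub_cmap invJ invD i w); split; first exact: cocycle_map.
suff -> : to_invariants_cmap i (sub_cmap invJ invD i w) = w.
  by rewrite subrr; apply: coboundary0.
apply: sub_incl_inj; rewrite [LHS]toK reynolds_id //.
exact: (span_inv (sub_inclP w)).
Qed.

End Backward.

Theorem augmented_descent (F : cpx C) (E : cpx kH) : derived_pullback eps F E ->
  (exists W : cpx kH, trivial_action W /\ derived_iso F (base_change s W)) <->
  cohomology_trivial E.
Proof.
move=> [P [p [KP qp EP]]]; rewrite (cohomology_trivial_derived_iso EP).
split=> [[W [trivW FW]]|tT]; first exact: descent_fibre_trivial trivW _ _ _ KP
  qp FW.
have [l ql] := resolution_by_trivial (@invariants_trivial P) KP tT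
  (to_invariants_quasi_iso tT).
(* P is the apex of the roof, with p to F and l to C (x) W. *)
by exists (invariants P); split; [exact: invariants_trivial|exists P, p, l].
Qed.
End Augmented.

(** * The coinvariant algebra *)

Section Coinvariants.
Variables (k : fieldType) (H : finGroupType) (n : nat).
Variable rho : mx_representation k [set: H] n.
Local Notation Sym := {mpoly k[n]}.

Lemma dhomog_big_prod (I : finType) (d : I -> nat) (F : I -> Sym) :
  (forall i, F i \is (d i).-homog) -> \prod_i F i \is (\sum_i d i)%N.-homog.
Proof.
move=> Fd; pose K (p : Sym) e := p \is e.-homog.
by apply: (big_ind2 K); rewrite /K; [apply: dhomog1|move=> p1 d1 p2 d2;
  apply: dhomogM|].
Qed.

Lemma sym_act_dhomog h m : sym_act rho h 'X_[m] \is (mdeg m).-homog.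
Proof.
rewrite mpolyXE_id rmorph_prod mdegE; apply: dhomog_big_prod => j.
have /(dhomogMn (m j)) : sym_act rho h 'X_j \is 1.-homog.
  rewrite sym_actX; apply: rpred_sum => i _; apply: dhomogZ.
  by rewrite dhomogX; apply/eqP/mdeg1.
by rewrite mul1n rmorphXn.
Qed.

(** Monomials suffice, and they are homogeneous. The action preserves degrees, so the sum over H of
    a monomial of positive degree is a generator of the coinvariant ideal; the monomial 1
    contributes #|H|. *)
Lemma coinv_pi_average p :
  coinv_pi rho (\sum_(h : H) sym_act rho h p) =
  coinv_const rho (#|H|%:R * p.@[fun=> 0]).
Proof.
suff X m : coinv_pi rho (\sum_(h : H) sym_act rho h 'X_[m]) =
    coinv_const rho (#|H|%:R * ('X_[m] : Sym).@[fun=> 0]).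
  have actE h : sym_act rho h p = \sum_(m <- msupp p) p@_m *: sym_act rho h
    'X_[m].
    by rewrite [in LHS](mpolyE p) rmorph_sum; apply: eq_bigr => m _;
      apply: sym_actZ.
  rewrite (eq_bigr _ (fun h _ => actE h)) exchange_big rmorph_sum.
  rewrite [in RHS](mpolyE p) raddf_sum mulr_sumr rmorph_sum.
  apply: eq_bigr => m _; rewrite -scaler_sumr /= mevalZ mulrCA -mul_mpolyC.
  by rewrite [LHS]rmorphM [RHS](rmorphM (coinv_const rho)); congr (_ * _);
    apply: X.
have [->|m0] := eqVneq m 0%MM.
  rewrite mpolyX0 meval1 mulr1 (eq_bigr (fun=> 1)) => [|h _];
    last exact: rmorph1.
  by rewrite sumr_const !rmorph_nat.
have -> : ('X_[m] : Sym).@[fun=> 0] = 0.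
  have [i mi] : exists i, m i != 0%N.
    apply/existsP; apply: contraNT m0; rewrite negb_exists => /forallP mi.
    by apply/eqP/mnmP => i; rewrite mnm0E; apply/eqP; have := mi i;
      rewrite negbK.
  by rewrite mevalX (bigD1 i) //= expr0n (negPf mi) mul0r.
rewrite mulr0 rmorph0 -[RHS](rmorph0 (coinv_pi rho)); apply/eqP.
rewrite coinv_pi_eq subr0.
apply: (@span_gen _ (Sym^o)); exists (mdeg m); split.
- by rewrite lt0n mdeg_eq0.
- by apply: rpred_sum => h _; apply: sym_act_dhomog.
move=> h; rewrite rmorph_sum [RHS](reindex_inj (mulgI h)).
by apply: eq_bigr => g _; symmetry; apply: sym_actM.
Qed.

Lemma coinv_average (c : coinv_gring rho) :
  \sum_(h : H) gact (coinv_gring rho) h c =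
  coinv_struct rho (#|H|%:R * coinv_point rho c).
Proof.
have [p ->] := coinv_pi_surj c.
under eq_bigr => h _ do rewrite [gact _ _ _]coinv_act_pi.
transitivity (coinv_pi rho (\sum_(h : H) sym_act rho h p)).
  by symmetry; apply: (rmorph_sum (coinv_pi rho)).
by rewrite coinv_pi_average [coinv_point rho _]coinv_eval0_pi.
Qed.

Lemma coinv_pointK a : coinv_point rho (coinv_struct rho a) = a.
Proof. by rewrite [LHS]coinv_eval0_pi mevalC. Qed.
End Coinvariants.

(* E is a model of the derived fibre i^*F with its H-representation. *)
Theorem proposition1p8 (k : fieldType) (char_k : [pchar k] =i pred0)
    (H : finGroupType) (n : nat) (rho : mx_representation k [set: H] n)
    (F : cpx (coinv_gring rho)) (E : cpx (triv_gring H k))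
    (iF : derived_pullback (coinv_point rho) F E) :
  descends F <-> cohomology_trivial E.
Proof.
exact: (augmented_descent char_k (@coinv_pointK _ _ _ rho) (@coinv_average _ _
  _ rho) iF).
Qed.
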